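(* Let $\kappa,c\in\mathbb{C}$ with $\kappa\neq0$. Then $W(\eta;\kappa,c)$ is a maximal submodule of $M(\eta)$ if and only if $(\kappa,c)$ is non-critical; and $V(\eta;\kappa,c)$ is an irreducible Whittaker module of type $\eta$ if and only if $(\kappa,c)$ is non-critical.
   Context: Fix $q\in\mathbb{C}\setminus\{0\}$ not a root of unity. $U=U_q(\mathfrak{sl}_3)$ is the associative $\mathbb{C}$-algebra generated by $E_1,E_2,F_1,F_2,K_1^{\pm1},K_2^{\pm1}$ subject to $K_iK_i^{-1}=K_i^{-1}K_i=1$, $K_1K_2=K_2K_1$, $[E_i,F_j]=\delta_{ij}\frac{K_i-K_i^{-1}}{q-q^{-1}}$, $K_iE_jK_i^{-1}=q^{a_{ij}}E_j$, $K_iF_jK_i^{-1}=q^{-a_{ij}}F_j$ for $i,j\in\{1,2\}$ with $a_{11}=a_{22}=2$, $a_{12}=a_{21}=-1$, and the quantum Serre relations $E_i^2E_j-(q+q^{-1})E_iE_jE_i+E_jE_i^2=0$, $F_i^2F_j-(q+q^{-1})F_iF_jF_i+F_jF_i^2=0$ for $i\neq j$. Let $U^+$ be the subalgebra generated by $E_1,E_2$. Fix $\alpha\in\mathbb{C}\setminus\{0\}$ and let $\eta:U^+\to\mathbb{C}$ be the algebra homomorphism with $\eta(E_1)=\alpha$, $\eta(E_2)=0$. $M(\eta)=U\otimes_{U^+}\mathbb{C}v_\eta$, where $xv_\eta=\eta(x)v_\eta$ for $x\in U^+$. A Whittaker module of type $\eta$ is a $U$-module generated by a nonzero vector $w$ with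 $E_1w=\alpha w$, $E_2w=0$. Put $K=K_1K_2^2$ and $C_1=F_1E_1+\frac{qK_1+q^{-1}K_1^{-1}}{(q-q^{-1})^2}$; $\mathbb{C}[K^{\pm1},C_1]$ is the commutative subalgebra they generate. For $\kappa\ne0$, $J(\kappa,c)$ is the ideal of $\mathbb{C}[K^{\pm1},C_1]$ generated by $K-\kappa$ and $C_1-c$; $W(\eta;\kappa,c)=U\,J(\kappa,c)v_\eta\subseteq M(\eta)$ and $V(\eta;\kappa,c)=M(\eta)/W(\eta;\kappa,c)$. For $n\in\mathbb{N}=\{1,2,\dots\}$ let $h_n(K,C_1)=q^{3-2n}K+q^{2n-3}K^{-1}-(q-q^{-1})^2C_1$. A pair $(\kappa,c)$ with $\kappa\neq0$ is critical if $h_n(\kappa,c)=0$ for some $n\in\mathbb{N}$, and non-critical otherwise. *)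

(* Defs.v *)
From HB Require Import structures.
From mathcomp Require Import all_boot all_order all_algebra.
From mathcomp Require Import complex.
From mathcomp Require Import Rstruct.
Set Implicit Arguments.
Unset Strict Implicit.
Unset Printing Implicit Defensive.
Import Order.TTheory GRing.Theory Num.Theory.
Local Open Scope ring_scope.

Definition C : numClosedFieldType := complex Rdefinitions.R.

Inductive letter := lE1 | lE2 | lF1 | lF2 | lK1 | lK1i | lK2 | lK2i.

Definition letter_to_nat (l : letter) : nat :=
  match l with lE1 => 0 | lE2 => 1 | lF1 => 2 | lF2 => 3
  | lK1 => 4 | lK1i => 5 | lK2 => 6 | lK2i => 7 end%N.
Definition nat_to_letter (n : nat) : letter :=
  match n with 0 => lE1 | 1 => lE2 | 2 => lF1 | 3 => lF2
  | 4 => lK1 | 5 => lK1i | 6 => lK2 | _ => lK2i end%N.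
Lemma letterK : cancel letter_to_nat nat_to_letter. Proof. by case. Qed.
HB.instance Definition _ := Equality.copy letter (can_type letterK).

(** Elements of the free associative algebra C<X> on the letters, represented
    as coefficient functions on words (the free algebra proper is the span of
    the monomials, [Falg] below).  Multiplication is concatenation-convolution. *)
Definition ncpoly := seq letter -> C.

Definition mono (w : seq letter) : ncpoly := fun v => (v == w)%:R.
Definition pzero : ncpoly := fun _ => 0.
Definition padd (f g : ncpoly) : ncpoly := fun w => f w + g w.
Definition pscale (a : C) (f : ncpoly) : ncpoly := fun w => a * f w.
Definition psub (f g : ncpoly) : ncpoly := padd f (pscale (-1) g).
Definition pmul (f g : ncpoly) : ncpoly :=
  fun w => \sum_(i < (size w).+1) f (take i w) * g (drop i w).
Definition pconst (a : C) : ncpoly := pscale a (mono [::]).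

Inductive lspan (S : ncpoly -> Prop) : ncpoly -> Prop :=
| lspan0 : lspan S pzero
| lspan_gen f : S f -> lspan S f
| lspan_add f g : lspan S f -> lspan S g -> lspan S (padd f g)
| lspan_scale a f : lspan S f -> lspan S (pscale a f).

Definition Falg : ncpoly -> Prop := lspan (fun f => exists w, f = mono w).

Definition subsetP (A B : ncpoly -> Prop) := forall f, A f -> B f.

Section Uq.
Variables (q alpha : C).

Definition lE (i : bool) := if i then lE2 else lE1.
Definition lF (i : bool) := if i then lF2 else lF1.
Definition lK (i : bool) := if i then lK2 else lK1.
Definition lKi (i : bool) := if i then lK2i else lK1i.
Definition gen (l : letter) : ncpoly := mono [:: l].

Definition cartan (i j : bool) : int := if i == j then 2 else -1.

(** the defining relations of U_q(sl_3) (each element r means r = 0) *)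
Definition Uq_rel (r : ncpoly) : Prop :=
  (exists i, r = psub (pmul (gen (lK i)) (gen (lKi i))) (mono [::]))
  \/ (exists i, r = psub (pmul (gen (lKi i)) (gen (lK i))) (mono [::]))
  \/ r = psub (pmul (gen lK1) (gen lK2)) (pmul (gen lK2) (gen lK1))
  \/ (exists i j, r = psub (psub (pmul (gen (lE i)) (gen (lF j)))
                                 (pmul (gen (lF j)) (gen (lE i))))
                           (pscale ((i == j)%:R / (q - q^-1))
                                   (psub (gen (lK i)) (gen (lKi i)))))
  \/ (exists i j, r = psub (pmul (gen (lK i)) (pmul (gen (lE j)) (gen (lKi i))))
                           (pscale (q ^ cartan i j) (gen (lE j))))
  \/ (exists i j, r = psub (pmul (gen (lK i)) (pmul (gen (lF j)) (gen (lKi i))))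
                           (pscale (q ^ (- cartan i j)) (gen (lF j))))
  \/ (exists i j, i != j /\
        r = padd (psub (mono [:: lE i; lE i; lE j])
                       (pscale (q + q^-1) (mono [:: lE i; lE j; lE i])))
                 (mono [:: lE j; lE i; lE i]))
  \/ (exists i j, i != j /\
        r = padd (psub (mono [:: lF i; lF i; lF j])
                       (pscale (q + q^-1) (mono [:: lF i; lF j; lF i])))
                 (mono [:: lF j; lF i; lF i])).

(** generators of the two-sided ideal I with U = Falg / I *)
Definition Iideal_gen (f : ncpoly) : Prop :=
  exists u v r, Uq_rel r /\ f = pmul (mono u) (pmul r (mono v)).

(** eta : U^+ -> C, eta(E1) = alpha, eta(E2) = 0, on words in E1, E2 *)
Definition isE (l : letter) : bool := (l == lE1) || (l == lE2).
Definition eta_word (w : seq letter) : C :=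
  if all (fun l => l == lE1) w then alpha ^+ size w else 0.

(** M(eta) = U (x)_{U^+} C v_eta = Falg / lspan Mgens, where Mgens are the
    generators of I together with the tensor relations u x - eta(x) u for
    u in U and x in U^+ (x ranging over words in E1, E2, which span U^+). *)
Definition Mgens (f : ncpoly) : Prop :=
  Iideal_gen f \/
  exists u w, all isE w /\
    f = pmul (mono u) (psub (mono w) (pconst (eta_word w))).

Definition Kel : ncpoly := mono [:: lK1; lK2; lK2].
Definition C1el : ncpoly :=
  padd (mono [:: lF1; lE1])
       (pscale ((q - q^-1) ^+ 2)^-1 (padd (pscale q (gen lK1)) (pscale q^-1 (gen lK1i)))).

(** W(eta; kappa, c) = U J(kappa,c) v_eta, i.e. the image in M(eta) of
    lspan Wgens = lspan Mgens + U (K - kappa) + U (C1 - c). *)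
Definition Wgens (kappa c : C) (f : ncpoly) : Prop :=
  Mgens f
  \/ (exists u, f = pmul (mono u) (psub Kel (pconst kappa)))
  \/ (exists u, f = pmul (mono u) (psub C1el (pconst c))).

(** A U-submodule of the quotient module Falg / B (B a left ideal of Falg
    containing I) is represented by its preimage T: a subspace with
    B <= T <= Falg stable under left multiplication by every generator. *)
Definition submod_of (B T : ncpoly -> Prop) : Prop :=
  subsetP B T /\ subsetP T Falg /\ subsetP (lspan T) T /\
  forall l f, T f -> T (pmul (gen l) f).

Definition maximal_submod (B S : ncpoly -> Prop) : Prop :=
  submod_of B S /\ (exists f, Falg f /\ ~ S f) /\
  forall T, submod_of B T -> subsetP S T -> subsetP T S \/ subsetP Falg T.

Definition whittaker_quot (B : ncpoly -> Prop) : Prop :=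
  exists v, Falg v /\ ~ B v /\
    B (psub (pmul (gen lE1) v) (pscale alpha v)) /\ B (pmul (gen lE2) v) /\
    forall T, submod_of B T -> T v -> subsetP Falg T.

Definition irreducible_quot (B : ncpoly -> Prop) : Prop :=
  (exists f, Falg f /\ ~ B f) /\
  forall T, submod_of B T -> subsetP T B \/ subsetP Falg T.

Definition h_n (n : nat) (kappa c : C) : C :=
  q ^ (3%:Z - 2%:Z * n%:Z) * kappa + q ^ (2%:Z * n%:Z - 3%:Z) * kappa^-1
  - (q - q^-1) ^+ 2 * c.

Definition critical (kappa c : C) : Prop :=
  exists n : nat, (0 < n)%N /\ h_n n kappa c = 0.

End Uq.

(* Main.v *)
(** Write F3 = F1F2 - qF2F1.  The quotient V = M(eta)/W has the PBW basis F2^a F3^b K2^k v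
    (a, b >= 0, k an integer): on the top layer span {K2^k v}, the relation K = kappa turns K1 into
    kappa K2^-2, and C1 = c determines F1.  Commuting the generators past F2^a F3^b gives explicit
    operators on coefficient functions, for which the defining relations are checked directly.
    The resulting map Phi from the free algebra to coefficient functions kills W, and the PBW
    monomials, which are independent under Phi, span modulo W; hence W is the kernel of Phi.

    The element K acts by kappa q^(-3m) on the span V_m of the vectors with a + b = m, and E1 is
    triangular on V_m with eigenvalues alpha q^k.  So a nonzero submodule contains, after a shift by
    a power of K2, a vector w in some V_m with E1 w = alpha w.  If m > 0, then E2 w <> 0 unless
    h_m(kappa, c) = 0, because the equations E1 w = alpha w, E2 w = 0 force w = 0 from the top
    coefficient (of F3^m) downwards.  Thus in the non-critical case one descends to v.
    If h_n(kappa, c) = 0, the same equations have a solution w in V_n with coefficients given by a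
    product of linear factors, and U w lives in degrees >= n, hence is a proper submodule. *)
From Stdlib Require Import FunctionalExtensionality Classical ClassicalDescription.
From Stdlib Require Import ClassicalEpsilon Setoid Morphisms.
Require Import Defs.
From mathcomp Require Import all_boot all_order all_algebra ring zify.
Set Implicit Arguments.
Unset Strict Implicit.
Unset Printing Implicit Defensive.
Import Order.TTheory GRing.Theory Num.Theory.
Local Open Scope ring_scope.

(** * Finitely supported functions *)

Section FiniteSums.
Variables (R : comNzRingType) (I : eqType).
Implicit Types (f g b : I -> R) (s t : seq I).

Definition covers s f := forall i, i \notin s -> f i = 0.
Definition fin_supp f := exists s, covers s f.

(** A list containing the support is picked by choice and freed of repetitions; the empty list is a
    default value for functions without finite support. *)
Definition supp f : seq I :=
  if excluded_middle_informative (fin_supp f) is left h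
  then undup (proj1_sig (constructive_indefinite_description _ h)) else [::].

(** The value at [f], read as a formal combination of basis elements, of the linear map sending
    basis element [i] to [b i]. *)
Definition pairing f b : R := \sum_(i <- supp f) f i * b i.

Lemma suppP f : fin_supp f -> uniq (supp f) /\ covers (supp f) f.
Proof.
rewrite /supp; case: excluded_middle_informative => // h _.
case: constructive_indefinite_description => s sf /=; split; first exact: undup_uniq.
by move=> i; rewrite mem_undup; apply: sf.
Qed.

Lemma pairingE s f b : uniq s -> covers s f -> pairing f b = \sum_(i <- s) f i * b i.
Proof.
move=> us sf; have [|ut tf] := @suppP f; first by exists s.
(* Discarding zero coefficients leaves two duplicate-free lists with the same members, hence
   permutations of each other. *)
have nzsum t : \sum_(i <- t) f i * b i = \sum_(i <- [seq i <- t | f i != 0]) f i * b i.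
  rewrite big_filter [LHS](bigID (fun i => f i != 0)) /= [X in _ + X]big1 ?addr0 // => i.
  by rewrite negbK => /eqP ->; rewrite mul0r.
rewrite /pairing nzsum [RHS]nzsum; apply/perm_big/uniq_perm; rewrite ?filter_uniq // => i.
rewrite !mem_filter /=; have [//|fi] := eqVneq (f i) 0.
have cov r : covers r f -> i \in r by move=> rf; apply: contraR fi => /rf ->.
by rewrite !cov.
Qed.

Lemma fin_supp_comb f g u v : fin_supp f -> fin_supp g -> fin_supp (fun i => u * f i + v * g i).
Proof.
move=> [s sf] [t tg]; exists (s ++ t) => i; rewrite mem_cat negb_or /= => /andP[/sf -> /tg ->].
by rewrite !mulr0 addr0.
Qed.

Lemma pairing_comb f g u v b : fin_supp f -> fin_supp g ->
  pairing (fun i => u * f i + v * g i) b = u * pairing f b + v * pairing g b.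
Proof.
move=> [s sf] [t tg]; pose r := undup (s ++ t).
have ur : uniq r by apply: undup_uniq.
have rf : covers r f by move=> i; rewrite mem_undup mem_cat negb_or => /andP[/sf].
have rg : covers r g by move=> i; rewrite mem_undup mem_cat negb_or => /andP[_ /tg].
rewrite !(@pairingE r) //; last by move=> i ir; rewrite rf ?rg // !mulr0 addr0.
by rewrite !mulr_sumr -big_split; apply: eq_bigr => i _ /=; ring.
Qed.

Lemma pairing0 b : pairing (fun=> 0) b = 0.
Proof. by rewrite (@pairingE [::]) ?big_nil. Qed.

Lemma fin_supp_single i : fin_supp (fun j => (j == i)%:R).
Proof. by exists [:: i] => j; rewrite inE => /negPf ->. Qed.

Lemma pairing_single i b : pairing (fun j => (j == i)%:R) b = b i.
Proof.
rewrite (@pairingE [:: i]) // ?big_seq1 ?eqxx ?mul1r // => j.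
by rewrite inE => /negPf ->.
Qed.
End FiniteSums.

(** * The module in PBW coordinates *)

Section Model.
Variables (F : fieldType) (q al ka c : F).
Hypotheses (q0 : q != 0) (al0 : al != 0) (ka0 : ka != 0).
Hypothesis nonroot : forall n : nat, (0 < n)%N -> q ^+ n != 1.

Lemma q2 : q ^+ 2 - 1 != 0.
Proof. by rewrite subr_eq0 nonroot. Qed.

(* x a b k is the coefficient of F2^a F3^b K2^k v.  Letting a and b range over all integers is
   harmless: the coefficients qn vanish exactly where an operator would leave the quadrant. *)
Definition vec := int -> int -> int -> F.

Definition qd : F := q - q^-1.
(** At [t = q^j] this is the quantum integer [j]. *)
Definition qn (t : F) : F := (t - t^-1) / qd.

(** Each operator is written on coefficients: its value at (a, b, k) collects the contributions of
    all basis vectors whose image involves F2^a F3^b K2^k v, so the shifts are opposite to those of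
    the exponents. *)
Definition opE1 (x : vec) : vec := fun a b k =>
  al * q ^ k * x (a + 0) (b + 0) (k + 0) + qn (q ^ (b + 1)) / ka * x (a + -1) (b + 1) (k + -2).
Definition opE2 (x : vec) : vec := fun a b k =>
  qn (q ^ (a + 1)) / qd * (x (a + 1) (b + 0) (k + -1) / (q ^ a * q ^ b)
     - q ^ a * q ^ b * x (a + 1) (b + 0) (k + 1))
  - q * qn (q ^ (b + 1)) / (al * q ^ b * q ^ k) *
    (c * x (a + 0) (b + 1) (k + -1)
     - (ka / q * x (a + 0) (b + 1) (k + 1) + q / ka * x (a + 0) (b + 1) (k + -3)) / qd ^+ 2).
(** The action of the root vector E3 = E1E2 - qE2E1, introduced to reduce the Serre relations for
    the E_i to q-commutation. *)
Definition opE3 (x : vec) : vec := fun a b k =>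
  qn (q ^ (a + 1)) * (al * q ^ a * q ^ b * q ^ k * q) * x (a + 1) (b + 0) (k + 1)
  + qn (q ^ (b + 1)) / qd * ((q ^ a) ^+ 2 * q ^ b * q / ka * x (a + 0) (b + 1) (k + -1)
    - ka * q / q ^ b * x (a + 0) (b + 1) (k + 1)).
Definition opF3 (x : vec) : vec := fun a b k => x (a + 0) (b + -1) (k + 0) / q ^ a.
Definition opF1 (x : vec) : vec := fun a b k =>
  qn (q ^ (a + 1)) * x (a + 1) (b + -1) (k + 0)
  + q ^ a / (al * q ^ b * q ^ k) *
    (c * x (a + 0) (b + 0) (k + 0)
     - (ka / q * x (a + 0) (b + 0) (k + 2) + q / ka * x (a + 0) (b + 0) (k + -2)) / qd ^+ 2).
Definition opF2 (x : vec) : vec := fun a b k => x (a + -1) (b + 0) (k + 0).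
Definition opK1 (x : vec) : vec := fun a b k => ka * q ^ a / q ^ b * x (a + 0) (b + 0) (k + 2).
Definition opK1i (x : vec) : vec := fun a b k => q ^ b / (ka * q ^ a) * x (a + 0) (b + 0) (k + -2).
Definition opK2 (x : vec) : vec := fun a b k => x (a + 0) (b + 0) (k + -1) / ((q ^ a) ^+ 2 * q ^ b).
Definition opK2i (x : vec) : vec := fun a b k => (q ^ a) ^+ 2 * q ^ b * x (a + 0) (b + 0) (k + 1).

(* Every argument of x in the operators is written as a shift (possibly by 0), so that after
   normalizing the shifts equal values of x become syntactically equal atoms for [field]. *)
Ltac shifts x :=
  rewrite -?addrA;
  repeat match goal with
  | |- context [?a + ?t] =>
    is_var a; lazymatch type of a with int => idtac end;
    lazymatch t with Posz _ => fail | Negz _ => fail | _ => idtac end;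
    let t' := eval vm_compute in t in change (a + t) with (a + t')
  end.

Ltac qfield x a b k :=
  rewrite /opE1 /opE2 /opE3 /opF3 /opF1 /opF2 /opK1 /opK1i /opK2 /opK2i /qn;
  shifts x; rewrite ?expfzDr //;
  let nA := fresh "nA" in let nB := fresh "nB" in let nD := fresh "nD" in
  have nA : q ^ a != 0 by [exact: expfz_neq0];
  have nB : q ^ b != 0 by [exact: expfz_neq0];
  have nD : q ^ k != 0 by [exact: expfz_neq0];
  move: (q ^ a) (q ^ b) (q ^ k) nA nB nD => ? ? ? nA nB nD; rewrite /qd /exprz;
  field; rewrite ?nA ?nB ?nD ?q0 ?al0 ?ka0 ?q2 //.

(** * Relations between the operators *)

Lemma opE3E x a b k : opE1 (opE2 x) a b k - q * opE2 (opE1 x) a b k = opE3 x a b k.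
Proof. qfield x a b k. Qed.

Lemma opE1E3 x a b k : opE1 (opE3 x) a b k = q^-1 * opE3 (opE1 x) a b k.
Proof. qfield x a b k. Qed.

Lemma opE3E2 x a b k : opE3 (opE2 x) a b k = q^-1 * opE2 (opE3 x) a b k.
Proof. qfield x a b k. Qed.

Lemma opF3E x a b k : opF1 (opF2 x) a b k - q * opF2 (opF1 x) a b k = opF3 x a b k.
Proof. qfield x a b k. Qed.

Lemma opF1F3 x a b k : opF1 (opF3 x) a b k = q^-1 * opF3 (opF1 x) a b k.
Proof. qfield x a b k. Qed.

Lemma opF3F2 x a b k : opF3 (opF2 x) a b k = q^-1 * opF2 (opF3 x) a b k.
Proof. qfield x a b k. Qed.

Lemma opE1F1 x a b k : opE1 (opF1 x) a b k - opF1 (opE1 x) a b k = (opK1 x a b k - opK1i x a b k) / qd.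
Proof. qfield x a b k. Qed.

Lemma opE1F2 x a b k : opE1 (opF2 x) a b k - opF2 (opE1 x) a b k = 0.
Proof. qfield x a b k. Qed.

Lemma opE2F1 x a b k : opE2 (opF1 x) a b k - opF1 (opE2 x) a b k = 0.
Proof. qfield x a b k. Qed.

Lemma opE2F2 x a b k : opE2 (opF2 x) a b k - opF2 (opE2 x) a b k = (opK2 x a b k - opK2i x a b k) / qd.
Proof. qfield x a b k. Qed.

Lemma opK1K2 x a b k : opK1 (opK2 x) a b k = opK2 (opK1 x) a b k.
Proof. qfield x a b k. Qed.

Lemma opE1K2 x a b k : opE1 (opK2 x) a b k = q * opK2 (opE1 x) a b k.
Proof. qfield x a b k. Qed.

Lemma opE1K2i x a b k : opE1 (opK2i x) a b k = q^-1 * opK2i (opE1 x) a b k.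
Proof. qfield x a b k. Qed.

(** * Powers of q and quantum integers *)

Lemma expz_eq1 (j : int) : q ^ j = 1 -> j = 0.
Proof.
case: j => [[|n]|n] //= E.
  by case/eqP: (nonroot (ltn0Sn n)).
by case/eqP: (nonroot (ltn0Sn n)); apply: invr_inj; rewrite invr1.
Qed.

Lemma expz_inj (i j : int) : q ^ i = q ^ j -> i = j.
Proof.
move=> E; apply/eqP; rewrite -subr_eq0; apply/eqP/expz_eq1.
by rewrite expfzDr // E -expfzDr // subrr.
Qed.

Lemma qd_neq0 : qd != 0.
Proof.
have E : qd = (q ^+ 2 - 1) / q by rewrite /qd; field; rewrite q0.
by rewrite E mulf_neq0 ?q2 ?invr_neq0.
Qed.

Lemma qn_neq0 (j : int) : j != 0 -> qn (q ^ j) != 0.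
Proof.
move=> j0; rewrite /qn mulf_neq0 ?invr_neq0 ?qd_neq0 // subr_eq0.
apply: contra j0 => /eqP E; have /expz_eq1/eqP : q ^ (j + j) = 1.
  by rewrite expfzDr // {1}E mulVf // expfz_neq0.
by rewrite -mulr2n mulrn_eq0.
Qed.

Lemma qn0 : qn (q ^ (0 : int)) = 0.
Proof. by rewrite /qn expr0z invr1 subrr mul0r. Qed.

(** * Eigenvectors from products of linear factors *)

Definition comb (s t : F) (x y : vec) : vec := fun a b k => s * x a b k + t * y a b k.

Definition nz (x : vec) := exists a b k, x a b k != 0.

Lemma nzN x : ~ nz x -> forall a b k, x a b k = 0.
Proof. by move=> nx a b k; apply/eqP/negP => /negP H; apply: nx; exists a, b, k. Qed.

Definition prodop (T : vec -> vec) (s : seq F) (x : vec) : vec :=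
  foldr (fun l y => comb 1 (- l) (T y) y) x s.

(** When the factors T - l are applied one after another and the result is zero, the last nonzero
    intermediate vector is killed by the next factor. *)
Lemma prodop_eigen (N : vec -> Prop) (T : vec -> vec) (s : seq F) (x : vec) :
  (forall l y, N y -> N (comb 1 (- l) (T y) y)) -> N x -> nz x -> ~ nz (prodop T s x) ->
  exists y l, [/\ N y, nz y, l \in s & forall a b k, T y a b k = l * y a b k].
Proof.
move=> NT Nx nzx; elim: s => [|l s IH] /= H; first by case: H.
have [nzy|nzy] := classic (nz (prodop T s x)); last first.
  by have [y [l' [? ? ls ?]]] := IH nzy; exists y, l'; split; rewrite // inE ls orbT.
exists (prodop T s x), l; split; rewrite ?inE ?eqxx //.
  by elim: (s) => [|? ? ?] //=; apply: NT.
move=> a b k; have := nzN H a b k; rewrite /comb mul1r mulNr => /eqP.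
by rewrite subr_eq0 => /eqP.
Qed.

Definition bounded (B : nat) (x : vec) := forall a b k : int,
  ~~ [&& 0 <= a <= B%:Z, 0 <= b <= B%:Z & - B%:Z <= k <= B%:Z] -> x a b k = 0.

Definition deg (m : nat) (x : vec) := forall a b k : int, a + b != m%:Z -> x a b k = 0.

(** The descent to v applies E1, E2 and the K_i, hence these closure conditions. *)
Record vsubmod (N : vec -> Prop) : Prop := VSubmod {
  vs_comb : forall s t x y, N x -> N y -> N (comb s t x y);
  vs_E1 : forall x, N x -> N (opE1 x);
  vs_E2 : forall x, N x -> N (opE2 x);
  vs_K1 : forall x, N x -> N (opK1 x);
  vs_K2 : forall x, N x -> N (opK2 x);
  vs_K2i : forall x, N x -> N (opK2i x)
}.

Definition opK (x : vec) := opK1 (opK2 (opK2 x)).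

Lemma opKE x a b k : opK x a b k = ka * (q ^ (a + b)) ^- 3 * x a b k.
Proof.
have -> : x a b k = x (a + 0) (b + 0) (k + 0) by rewrite !addr0.
rewrite /opK; qfield x a b k.
Qed.

Definition delta (i j l : int) : vec := fun a b k => ((a == i) && (b == j) && (k == l))%:R.

(** * Irreducibility in the non-critical case *)

Section Submodule.
Variable N : vec -> Prop.
Hypotheses (sN : vsubmod N) (bN : forall x, N x -> exists B, bounded B x).

(** K acts on the layer a + b = m by ka q^(-3m), and these scalars are distinct, so a K-eigenvector
    lies in a single layer. A product of factors K - ka q^(-3m) produces one from the finitely
    supported [x]. *)
Lemma homogeneous_vector x : N x -> nz x -> exists m y, [/\ N y, nz y & deg m y].
Proof.
move=> Nx nzx; have [B bx] := bN Nx.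
have NT : forall l y, N y -> N (comb 1 (- l) (opK y) y).
  by move=> l y Ny; apply: (vs_comb sN) => //; apply/(vs_K1 sN)/(vs_K2 sN)/(vs_K2 sN).
(* On the box of size B the degree a + b runs from 0 to 2B. *)
pose s := [seq ka * (q ^ (m%:Z)) ^- 3 | m <- iota 0 (B + B).+1].
have [|y [l [Ny [a0 [b0 [k0 y0]]] _ yl]]] := prodop_eigen (s := s) NT Nx nzx.
  move=> [a [b [k]]] /negP; apply; apply/eqP.
  have E : prodop opK s x a b k = \prod_(l <- s) (ka * (q ^ (a + b)) ^- 3 - l) * x a b k.
    elim: (s) => [|l s' IH] /=; first by rewrite big_nil mul1r.
    by rewrite big_cons /comb opKE IH; ring.
  have [ab|nab] := boolP [&& 0 <= a <= B%:Z, 0 <= b <= B%:Z & - B%:Z <= k <= B%:Z].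
    rewrite E (big_rem (ka * (q ^ (a + b)) ^- 3)) /= ?subrr ?mul0r //.
    apply/mapP; exists (absz (a + b)); last by congr (_ * (q ^ _) ^- _); lia.
    by rewrite mem_iota; lia.
  by rewrite E bx ?mulr0.
have [B' by'] := bN Ny.
have ab0 : [&& 0 <= a0 <= B'%:Z, 0 <= b0 <= B'%:Z & - B'%:Z <= k0 <= B'%:Z].
  by apply: contraR y0 => H; rewrite by'.
exists (absz (a0 + b0)), y; split=> //; first by exists a0, b0, k0.
(* Two nonzero coefficients have the same K-eigenvalue, hence the same degree. *)
move=> a b k nab; apply/eqP; apply: contraR nab => yab.
have := yl a0 b0 k0; rewrite opKE => /(mulIf y0) El.
have := yl a b k; rewrite opKE => /(mulIf yab); rewrite -El => /(mulfI ka0)/invr_inj.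
rewrite !exprnP !exprz_exp => /expz_inj; lia.
Qed.

Lemma opE1E x a b k : opE1 x a b k =
  al * q ^ k * x a b k + qn (q ^ (b + 1)) / ka * x (a - 1) (b + 1) (k - 2).
Proof. by rewrite /opE1 !addr0. Qed.

Lemma opE1_deg m x : deg m x -> deg m (opE1 x).
Proof. by move=> dx a b k ab; rewrite opE1E !dx ?mulr0 ?addr0 //; lia. Qed.

Lemma comb_deg m s t x y : deg m x -> deg m y -> deg m (comb s t x y).
Proof. by move=> dx dy a b k ab; rewrite /comb dx ?dy ?mulr0 ?addr0. Qed.

(* E1 is triangular with respect to b, with eigenvalues al q^k on the diagonal: the product of the
   E1 - al q^k over the finitely many k in the support kills the part with top b. *)
Lemma E1_eigenvector m y : N y -> nz y -> deg m y ->
  exists w j, [/\ N w, nz w, deg m w & forall a b k, opE1 w a b k = al * q ^ j * w a b k].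
Proof.
move=> Ny nzy dy; have [B By] := bN Ny.
have {By} : forall a b k : int, B.+1%:Z <= b -> y a b k = 0.
  by move=> a b k Bb; apply: By; lia.
(* Induction on a strict upper bound for the exponent b; the bound 0 is impossible for a nonzero
   vector. *)
move: B.+1 => {}B; elim: B y Ny nzy dy => [|B IH] y Ny nzy dy By.
  case: nzy => a [b [k]]; have [b0|b0] := boolP (0 <= b); first by rewrite By ?eqxx.
  have [B bB] := bN Ny; rewrite bB ?eqxx //; lia.
have [D bD] := bN Ny.
pose s := [seq al * q ^ (n%:Z - D%:Z) | n <- iota 0 (D + D).+1].
pose Q z := [/\ N z, deg m z & forall a b k : int, B.+1%:Z <= b -> z a b k = 0].
have QT l z : Q z -> Q (comb 1 (- l) (opE1 z) z).
  case=> Nz dz zB; split; first by apply: (vs_comb sN) => //; apply: (vs_E1 sN).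
    by apply: comb_deg => //; apply: opE1_deg.
  by move=> a b k Bb; rewrite /comb opE1E !zB ?(mulr0, addr0) //; lia.
have Qy : Q y by [].
have Qs s' : Q (prodop opE1 s' y) by elim: s' => [|l s' IHs] //=; apply: QT.
(* If the full product vanishes, an eigenvector appears among the partial products. Otherwise the
   product is nonzero and has lost the row b = B, so the induction hypothesis applies. *)
have [nzs|nzs] := classic (nz (prodop opE1 s y)); last first.
  have [w [l [[Nw dw _] nzw /mapP[n _ ->] El]]] := prodop_eigen QT Qy nzy nzs.
  by exists w, (n%:Z - D%:Z).
have [Nz dz zB] := Qs s.
apply: (IH (prodop opE1 s y)) => // a b k; rewrite le_eqVlt => /predU1P[<-|Bb]; last first.
  by apply: zB; lia.
have E : prodop opE1 s y a B k = \prod_(l <- s) (al * q ^ k - l) * y a B k.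
  elim: (s) => [|l s' IHs] /=; first by rewrite big_nil mul1r.
  have [_ _ z0] := Qs s'.
  by rewrite big_cons /comb opE1E (z0 (a - 1)) ?IHs; [ring | lia].
have [ab|nab] := boolP (- D%:Z <= k <= D%:Z); last first.
  by rewrite E bD ?mulr0 //; lia.
rewrite E (big_rem (al * q ^ k)) /= ?subrr ?mul0r //.
apply/mapP; exists (absz (k + D%:Z)); last by congr (_ * q ^ _); lia.
by rewrite mem_iota; lia.
Qed.

(** K2 and its inverse multiply the E1-eigenvalue by q and q^-1, so a shift by K2^(-j) turns al q^j
    into al. *)
Lemma K2_shift m j w : N w -> nz w -> deg m w ->
    (forall a b k, opE1 w a b k = al * q ^ j * w a b k) ->
  exists w', [/\ N w', nz w', deg m w' & forall a b k, opE1 w' a b k = al * w' a b k].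
Proof.
have up i x : (forall a b k, opE1 x a b k = al * q ^ i * x a b k) ->
    forall a b k, opE1 (opK2 x) a b k = al * q ^ (i + 1) * opK2 x a b k.
  by move=> Ex a b k; rewrite opE1K2 /opK2 Ex expfzDr // expr1z; ring.
have down i x : (forall a b k, opE1 x a b k = al * q ^ i * x a b k) ->
    forall a b k, opE1 (opK2i x) a b k = al * q ^ (i - 1) * opK2i x a b k.
  by move=> Ex a b k; rewrite opE1K2i /opK2i Ex expfzDr // exprN1; ring.
have nzup x : nz x -> nz (opK2 x).
  case=> a [b [k w0]]; exists a, b, (k + 1).
  by rewrite /opK2 !addr0 addrK !mulf_neq0 // ?invr_neq0 ?mulf_neq0 ?expf_neq0 ?expfz_neq0.
have nzdown x : nz x -> nz (opK2i x).
  case=> a [b [k w0]]; exists a, b, (k - 1).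
  by rewrite /opK2i !addr0 subrK !mulf_neq0 // ?expf_neq0 ?expfz_neq0.
have degup x : deg m x -> deg m (opK2 x).
  by move=> dx a b k ab; rewrite /opK2 !addr0 dx ?mul0r.
have degdown x : deg m x -> deg m (opK2i x).
  by move=> dx a b k ab; rewrite /opK2i !addr0 dx ?mulr0.
elim: j w => [|n IH|n IH] w Nw nzw dw Ew.
- by exists w; split=> // a b k; rewrite Ew expr0z mulr1.
- apply: (IH (opK2i w)); first exact: (vs_K2i sN).
  + exact: nzdown.
  + exact: degdown.
  + by have -> : n%:Z = n.+1%:Z - 1 by [lia]; apply: down.
- apply: (IH (opK2 w)); first exact: (vs_K2 sN).
  + exact: nzup.
  + exact: degup.
  + by have -> : - n%:Z = - n.+1%:Z + 1 by [lia]; apply: up.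
Qed.

(** A copy of [h_n] over the field [F], kept convertible to it. *)
Definition hpol (n : nat) : F :=
  q ^ (3%:Z - 2%:Z * n%:Z) * ka + q ^ (2%:Z * n%:Z - 3%:Z) * ka^-1 - (q - q^-1) ^+ 2 * c.

Lemma hpolS m : hpol m.+1 = q / (q ^ m%:Z) ^+ 2 * ka + (q ^ m%:Z) ^+ 2 / q / ka - qd ^+ 2 * c.
Proof.
rewrite /hpol -/qd; congr (_ * _ + _ * _ - _).
  have -> : 3%:Z - 2%:Z * m.+1%:Z = 1 - (m%:Z + m%:Z) by lia.
  by rewrite expfzDr // -invr_expz expfzDr // expr2.
have -> : 2%:Z * m.+1%:Z - 3%:Z = (m%:Z + m%:Z) - 1 by lia.
by rewrite expfzDr // expfzDr // expr2 exprN1.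
Qed.

(** Here M = q^m, n = [m+1], and X, Y0, Y2 stand for the coefficients of w at (0, m+1, 0), (1, m,
    0), (1, m, 2). Solving the outer equations for Y2 and Y0 and substituting in the middle one
    leaves X h_(m+1) = 0. *)
Lemma top_coefficient (M n X Y0 Y2 : F) : M != 0 -> n != 0 ->
    al * (q ^+ 2 - 1) * Y2 = - (n / ka * X) ->
    qn q / qd * (Y0 / M - M * Y2) = n / (al * M) * (c * X) ->
    qn q / qd * (M * Y0) = q ^+ 2 * n / (al * M) * (ka / q * X) / qd ^+ 2 ->
  X * (q / M ^+ 2 * ka + M ^+ 2 / q / ka - qd ^+ 2 * c) = 0.
Proof.
move=> M0 n0 e2 e1 e0.
have qq : qn q = 1 by [rewrite /qn divff ?qd_neq0]; rewrite qq in e0 e1.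
have e3 : Y2 = - (n / ka * X) / (al * (q ^+ 2 - 1)).
  by rewrite -e2; field; rewrite ?q2 ?al0.
have e4 : Y0 = q * n / (al * M ^+ 2) * (ka * X) / qd.
  have -> : Y0 = 1 / qd * (M * Y0) * (qd / M) by field; rewrite ?M0 ?qd_neq0.
  by rewrite e0; field; rewrite ?M0 ?al0 ?qd_neq0 ?q0.
apply: (mulfI n0); rewrite mulr0.
have -> : n * (X * (q / M ^+ 2 * ka + M ^+ 2 / q / ka - qd ^+ 2 * c)) =
  al * M * qd ^+ 2 * (1 / qd * (Y0 / M - M * Y2) - n / (al * M) * (c * X)).
  by rewrite e3 e4 /qd; field; rewrite ?M0 ?al0 ?ka0 ?q2 ?q0.
by rewrite e1 subrr mulr0.
Qed.

Lemma singular_eq0 m w : hpol m.+1 != 0 -> N w -> deg m.+1 w ->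
    (forall a b k, opE1 w a b k = al * w a b k) -> (forall a b k, opE2 w a b k = 0) ->
  ~ nz w.
Proof.
move=> hm Nw dw w1 w2.
have [B bw] := bN Nw.
have e1 a b k : al * (q ^ k - 1) * w a b k = - (qn (q ^ (b + 1)) / ka * w (a - 1) (b + 1) (k - 2)).
  have /eqP := w1 a b k; rewrite opE1E -subr_eq0 => /eqP H.
  by apply/eqP; rewrite -addr_eq0 -H; apply/eqP; ring.
have off b : (forall a k, w a (b + 1) k = 0) -> forall a k, k != 0 -> w a b k = 0.
  move=> wb a k k0; have /eqP := e1 a b k; rewrite wb mulr0 oppr0 !mulf_eq0 (negPf al0) subr_eq0 /=.
  by case/orP=> /eqP // /expz_eq1 E; rewrite E in k0.
have top : forall a b k : int, m.+1%:Z < b -> w a b k = 0.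
  move=> a b k mb; have [ab|ab] := eqVneq (a + b) m.+1; last exact: dw.
  by apply: bw; lia.
have z1 : forall k, w 0 m.+1 k = 0.
  have t k : k != 0 -> w 0 m.+1 k = 0.
    by apply: off => a k'; apply: top; lia.
  move=> k; have [-> {k}|] := eqVneq k 0; last exact: t.
  (* The E1-equation at k = -2 gives w(1, m, -2) = 0; the other three equations become the
     hypotheses of [top_coefficient]. *)
  have e3 := e1 1 m (- 2); have e4 := e1 1 m 2; have e5 := w2 0 m 1; have e6 := w2 0 m (- 1).
  have mE : m%:Z + 1 = m.+1 by lia.
  move: e3 e4 e5 e6; rewrite /opE2 /= ?addr0 ?add0r ?subrr ?expr1z ?expr0z !mul1r !mE.
  rewrite (t (- 2 - 2)) // (t (1 + 1)) // !(t (_ - 3)) //.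
  rewrite [1 + 1](_ : _ = 2 :> int) // [w 1 m (_ - 1)](_ : _ = w 1 m (- 2)) //.
  rewrite !mulr0 oppr0 => /eqP.
  rewrite !mulf_eq0 (negPf al0) subr_eq0 /= => /orP[/eqP/expz_eq1 //|/eqP ->].
  move=> e4 e5 e6.
  have M0 : q ^ m%:Z != 0 by rewrite expfz_neq0.
  have n0 : qn (q ^ m.+1%:Z) != 0 by rewrite qn_neq0.
  have H := @top_coefficient (q ^ m%:Z) (qn (q ^ m.+1%:Z)) (w 0 m.+1 0) (w 1 m 0) (w 1 m 2) M0 n0 e4.
  rewrite -hpolS in H; 
  have /eqP : w 0 m.+1 0 * hpol m.+1 = 0.
    apply: H; apply/eqP; rewrite -subr_eq0.
      by rewrite -[X in _ == X]e5; apply/eqP; field; rewrite M0 q0 al0 qd_neq0.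
    rewrite -oppr_eq0 -[X in _ == X]e6 exprN1; apply/eqP; field.
    by rewrite M0 q0 al0 qd_neq0.
  by rewrite mulf_eq0 (negPf hm) orbF => /eqP.
(* Descending induction on b, with d an upper bound for m + 1 - b. *)
have z (d : nat) : forall a b k : int, m.+1%:Z <= b + d%:Z -> w a b k = 0.
  elim: d => [|d IH] a b k mb.
    have [ab|ab] := eqVneq (a + b) m.+1; last exact: dw.
    have [bm|bm] := eqVneq b m.+1; last by apply: top; lia.
    have -> : a = 0 by lia.
    by rewrite bm z1.
  have wb a' k' : w a' (b + 1) k' = 0 by apply: IH; lia.
  have [-> {k}|k0] := eqVneq k 0; last exact: off.
  have [ab|ab] := eqVneq (a + b) m.+1; last exact: dw.
  have [bm|bm] := boolP (m.+1%:Z <= b); first by apply: IH; lia.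
  (* Evaluation at k = 1 isolates the coefficient at 0, because the one at 2 vanishes by [off]. *)
  have := w2 (a - 1) b 1; rewrite /opE2 !addr0 subrK !wb (off b wb a (1 + 1)) // subrr.
  rewrite !(mulr0, subr0, addr0, mul0r).
  have a0 : a != 0 by lia.
  have n0 := mulf_neq0 (qn_neq0 a0) (invr_neq0 qd_neq0).
  rewrite -[RHS](mulr0 (qn (q ^ a) / qd)) => /(mulfI n0)/eqP.
  by rewrite mulf_eq0 invr_eq0 mulf_eq0 !(negPf (expfz_neq0 _ q0)) !orbF => /eqP.
case=> a [b [k]]; rewrite (z (absz (m.+1%:Z - b))) ?eqxx //; lia.
Qed.

Lemma opE2_deg m x : deg m.+1 x -> deg m (opE2 x).
Proof. by move=> dx a b k ab; rewrite /opE2 !dx ?(mulr0, mul0r, addr0, oppr0) //; lia. Qed.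

Lemma bounded_neg B x : bounded B x -> forall a b k : int, (a < 0) || (b < 0) -> x a b k = 0.
Proof. by move=> bx a b k ab; apply: bx; lia. Qed.

(** Descent on the degree: an E1-eigenvector of eigenvalue al in degree m + 1 is not killed by E2,
    which lowers the degree by one. In degree 0 such an eigenvector is a multiple of v. *)
Lemma vsubmod_delta x : (forall n, hpol n.+1 != 0) -> N x -> nz x -> N (delta 0 0 0).
Proof.
move=> hn Nx nzx; have [m [y [Ny nzy dy]]] := homogeneous_vector Nx nzx.
elim: m y Ny nzy dy => [|m IH] y Ny nzy dy;
  have [v [j [Nv nzv dv Ev]]] := E1_eigenvector Ny nzy dy;
  have [w [Nw nzw dw Ew]] := K2_shift Nv nzv dv Ev; last first.
  apply: (IH (opE2 w)); [exact: (vs_E2 sN) | | exact: opE2_deg].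
  have [//|/nzN w2] := classic (nz (opE2 w)).
  by case: (singular_eq0 (hn m) Nw dw Ew w2).
have [B bw] := bN Nw.
(* In degree 0 only the K2^k v remain, and the eigenvalue equation gives q^k = 1. *)
have w0 a b k : [|| a != 0, b != 0 | k != 0] -> w a b k = 0.
  have [ab|nab] := boolP ((a < 0) || (b < 0)); first by rewrite (bounded_neg bw).
  have [ab|ab] := eqVneq (a + b) 0; last by rewrite dw.
  move=> abk; have [-> ->] : a = 0 /\ b = 0 by lia.
  have k0 : k != 0 by lia.
  have wN : w (0 - 1) (0 + 1) (k - 2) = 0 by apply: (bounded_neg bw).
  have := Ew 0 0 k; rewrite opE1E wN mulr0 addr0 => /eqP.
  rewrite -subr_eq0 -mulrBl mulf_eq0 -[X in _ - X]mulr1 -mulrBr mulf_eq0 (negPf al0) subr_eq0 /=.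
  by case/orP=> /eqP // /expz_eq1 k1; rewrite k1 in k0.
have w1 : w 0 0 0 != 0.
  case: nzw => a [b [k]]; apply: contraNneq => w1.
  have [/and3P[/eqP-> /eqP-> /eqP->]|] := boolP [&& a == 0, b == 0 & k == 0]; first by rewrite w1.
  by rewrite !negb_and => /w0 ->.
suff -> : delta 0 0 0 = comb (w 0 0 0)^-1 0 w w by apply: (vs_comb sN).
apply: functional_extensionality => a; apply: functional_extensionality => b.
apply: functional_extensionality => k; rewrite /comb mul0r addr0 /delta.
have [/and3P[/eqP-> /eqP-> /eqP->]|H] := boolP [&& a == 0, b == 0 & k == 0].
  by rewrite !eqxx mulVf.
by rewrite -andbA (negPf H) (w0 a b k) ?mulr0 //; move: H; rewrite !negb_and.
Qed.
End Submodule.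

(** * Action of the letters and the defining relations *)

Lemma opK1F1 x a b k : opK1 (opF1 x) a b k = q ^- 2 * opF1 (opK1 x) a b k.
Proof. qfield x a b k. Qed.

Lemma opK1F2 x a b k : opK1 (opF2 x) a b k = q * opF2 (opK1 x) a b k.
Proof. qfield x a b k. Qed.

Lemma opK2F1 x a b k : opK2 (opF1 x) a b k = q * opF1 (opK2 x) a b k.
Proof. qfield x a b k. Qed.

Lemma opK2F2 x a b k : opK2 (opF2 x) a b k = q ^- 2 * opF2 (opK2 x) a b k.
Proof. qfield x a b k. Qed.

Lemma opK1iF1 x a b k : opK1i (opF1 x) a b k = q ^+ 2 * opF1 (opK1i x) a b k.
Proof. qfield x a b k. Qed.

Lemma opK1iF2 x a b k : opK1i (opF2 x) a b k = q^-1 * opF2 (opK1i x) a b k.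
Proof. qfield x a b k. Qed.

Lemma opK2iF1 x a b k : opK2i (opF1 x) a b k = q^-1 * opF1 (opK2i x) a b k.
Proof. qfield x a b k. Qed.

Lemma opK2iF2 x a b k : opK2i (opF2 x) a b k = q ^+ 2 * opF2 (opK2i x) a b k.
Proof. qfield x a b k. Qed.

Lemma opE2K2 x a b k : opE2 (opK2 x) a b k = q ^- 2 * opK2 (opE2 x) a b k.
Proof. qfield x a b k. Qed.

Lemma opE2K2i x a b k : opE2 (opK2i x) a b k = q ^+ 2 * opK2i (opE2 x) a b k.
Proof. qfield x a b k. Qed.

Definition op (l : letter) : vec -> vec :=
  match l with
  | lE1 => opE1 | lE2 => opE2 | lF1 => opF1 | lF2 => opF2
  | lK1 => opK1 | lK1i => opK1i | lK2 => opK2 | lK2i => opK2i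
  end.

Lemma op_comb l s t x y a b k : op l (comb s t x y) a b k = comb s t (op l x) (op l y) a b k.
Proof.
by case: l; rewrite /comb /= /opE1 /opE2 /opF1 /opF2 /opK1 /opK1i /opK2 /opK2i; ring.
Qed.

Lemma op_KKi i x a b k : op (lK i) (op (lKi i) x) a b k = x a b k.
Proof.
have -> : x a b k = x (a + 0) (b + 0) (k + 0) by rewrite !addr0.
by case: i; rewrite /=; qfield x a b k.
Qed.

Lemma op_KiK i x a b k : op (lKi i) (op (lK i) x) a b k = x a b k.
Proof.
have -> : x a b k = x (a + 0) (b + 0) (k + 0) by rewrite !addr0.
by case: i; rewrite /=; qfield x a b k.
Qed.

Lemma op_EF i j x a b k : op (lE i) (op (lF j) x) a b k - op (lF j) (op (lE i) x) a b k =
  (i == j)%:R / qd * (op (lK i) x a b k - op (lKi i) x a b k).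
Proof.
case: i; case: j; rewrite /= ?mul0r ?opE1F2 ?opE2F1 //; first by rewrite opE2F2; ring.
by rewrite opE1F1; ring.
Qed.

Lemma op_KEKi i j x a b k :
  op (lK i) (op (lE j) (op (lKi i) x)) a b k = q ^ cartan i j * op (lE j) x a b k.
Proof. by case: i; case: j; rewrite /= -?exprnP ?exprN1; qfield x a b k. Qed.

Lemma op_KFKi i j x a b k :
  op (lK i) (op (lF j) (op (lKi i) x)) a b k = q ^ (- cartan i j) * op (lF j) x a b k.
Proof. by case: i; case: j; rewrite /= ?opprK ?expr1z -?invr_expz -?exprnP; qfield x a b k. Qed.

Lemma vecP (x y : vec) : (forall a b k, x a b k = y a b k) -> x = y.
Proof.
move=> E; apply: functional_extensionality => a; apply: functional_extensionality => b.
by apply: functional_extensionality => k.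
Qed.

(** With T = lm - q ml, the two Serre relations are l T - q^-1 T l = 0 and T m - q^-1 m T = 0
    written out. *)
Lemma qserre (l m : letter) (T : vec -> vec) :
    (forall x a b k, op l (op m x) a b k - q * op m (op l x) a b k = T x a b k) ->
    (forall x a b k, op l (T x) a b k = q^-1 * T (op l x) a b k) ->
    (forall x a b k, T (op m x) a b k = q^-1 * op m (T x) a b k) ->
  forall x a b k,
    op l (op l (op m x)) a b k - (q + q^-1) * op l (op m (op l x)) a b k
      + op m (op l (op l x)) a b k = 0 /\
    op m (op m (op l x)) a b k - (q + q^-1) * op m (op l (op m x)) a b k
      + op l (op m (op m x)) a b k = 0.
Proof.
move=> TE lT Tm x a b k.
have TE' y : T y = comb 1 (- q) (op l (op m y)) (op m (op l y)).
  by apply: vecP => a' b' k'; rewrite -TE /comb; ring.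
have := lT x a b k; have := Tm x a b k; rewrite !TE' !op_comb /comb => E1 E2; split.
  apply/eqP; rewrite addrC -[X in _ == X](subrr (q^-1 * (1 * op l (op m (op l x)) a b k +
    - q * op m (op l (op l x)) a b k))) -{1}E2; apply/eqP; field; exact: q0.
apply/eqP; rewrite -[X in _ == X](subrr (q^-1 * (1 * op m (op l (op m x)) a b k +
    - q * op m (op m (op l x)) a b k))) -{1}E1; apply/eqP; field; exact: q0.
Qed.

Lemma op_EE i j x a b k : i != j -> op (lE i) (op (lE i) (op (lE j) x)) a b k
  - (q + q^-1) * op (lE i) (op (lE j) (op (lE i) x)) a b k + op (lE j) (op (lE i) (op (lE i) x)) a b k = 0.
Proof.
have [E12 E21] := @qserre lE1 lE2 opE3 opE3E opE1E3 opE3E2 x a b k.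
by case: i; case: j.
Qed.

Lemma op_FF i j x a b k : i != j -> op (lF i) (op (lF i) (op (lF j) x)) a b k
  - (q + q^-1) * op (lF i) (op (lF j) (op (lF i) x)) a b k + op (lF j) (op (lF i) (op (lF i) x)) a b k = 0.
Proof.
have [E12 E21] := @qserre lF1 lF2 opF3 opF3E opF1F3 opF3F2 x a b k.
by case: i; case: j.
Qed.

Lemma op0 l : op l (fun _ _ _ => 0) = fun _ _ _ => 0.
Proof.
by apply: vecP => a b k; case: l; rewrite /= /opE1 /opE2 /opF1 /opF2 /opK1 /opK1i /opK2 /opK2i; ring.
Qed.

(** * The submodule generated by a singular vector *)

Section Critical.
Variable n : nat.
Hypothesis hn : hpol n = 0.

(* This recursion is the equation E2 w = 0 in degree n after dividing both sides by the common
   factor K2^2 - q^(2n-2), which is available because hpol n = 0. *)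
Fixpoint sing_coef (i : nat) (k : int) : F :=
  if i is j.+1 then
    q ^ j%:Z * qn (q ^ n%:Z / q ^ j%:Z) / (qn (q ^ j%:Z * q) * al * qd)
    * (q ^+ 3 / (q ^ n%:Z) ^+ 2 * ka / q ^ k * sing_coef j k - q / (ka * q ^ k) * sing_coef j (k - 2))
  else (k == 0)%:R.

(** Normalised to have coefficient 1 at F3^n v, and extended by zero outside the nonnegative points
    of a + b = n. *)
Definition sing : vec := fun a b k =>
  if a is Posz i then if (0 <= b) && (a + b == n) then sing_coef i k else 0 else 0.

(** The recursion encodes E2 w = 0; this is the companion equation E1 w = al w. In the inductive
    step the coefficients of index [i] are eliminated, and the factor [i+2] that appears cancels the
    denominator of the recursion. *)
Lemma sing_coefP i k : al * (q ^ k - 1) * sing_coef i.+1 k =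
  - qn (q ^ n%:Z / q ^ i%:Z) / ka * sing_coef i (k - 2).
Proof.
have Z0 (l : int) : q ^ l != 0 by rewrite expfz_neq0.
elim: i k => [|i IH] k.
  rewrite /= expr0z !mul1r invr1 mulr1.
  have -> : qn q = 1 by rewrite /qn divff ?qd_neq0.
  rewrite subr_eq0; have [->|k0] := eqVneq k 0.
    by rewrite expr0z subrr mulr0 mul0r /= mulr0.
  have [->|k2] := eqVneq k 2; last by rewrite !mulr0 subrr !mulr0.
  rewrite -exprnP /= /qd; field; rewrite ?al0 ?ka0 ?q0 ?q2 ?expf_neq0 //.
have nA (j : nat) : qn (q ^ j%:Z * q) != 0.
  by rewrite -[X in _ * X]expr1z -expfzDr // qn_neq0 //; lia.
(* The trivial equation is unfolded on its right side to make the recursion available as a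
   hypothesis. *)
have := IH k; have := IH (k - 2); have : sing_coef i.+1 (k - 2) = sing_coef i.+1 (k - 2) by [].
rewrite [in RHS]/= -/(sing_coef i.+1).
have -> : sing_coef i.+2 k = q ^ i.+1%:Z * qn (q ^ n%:Z / q ^ i.+1%:Z) / (qn (q ^ i.+1%:Z * q) * al * qd)
    * (q ^+ 3 / (q ^ n%:Z) ^+ 2 * ka / q ^ k * sing_coef i.+1 k - q / (ka * q ^ k) * sing_coef i.+1 (k - 2)) by [].
have qS : q ^ i.+1%:Z = q ^ i%:Z * q by rewrite -addn1 PoszD expfzDr // expr1z.
have qk : q ^ (k - 2) = q ^ k / q ^+ 2 by rewrite expfzDr //.
rewrite qk; move: (nA i) (nA i.+1); rewrite qS.
move: (Z0 i) (Z0 k) (Z0 n) (sing_coef i.+1 k) (sing_coef i.+1 (k - 2)) (sing_coef i (k - 2)) (sing_coef i (k - 2 - 2)).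
move: (q ^ i) (q ^ k) (q ^ n) (qn (q ^ n%:Z / q ^ i%:Z)) => A Z M ni A0 Z1 M0 X Y X' Y' m1 m2 hYd hY hX.
move: (qn (M / (A * q))) => ni1.
have hX' : q ^+ 3 / M ^+ 2 * ka / Z * (al * (Z - 1) * X) =
    - (1 / (A * ka * q ^+ 2)) * (qn (A * q) * al * qd * Y - A * q ^+ 3 / Z * (al * (Z / q ^+ 2 - 1) * Y)).
  rewrite hX hY {1}hYd; field.
  by rewrite ?A0 ?Z1 ?M0 ?q0 ?ka0 ?al0 ?m1 ?qd_neq0.
have key : q ^+ 3 / M ^+ 2 * ka / Z * (al * (Z - 1) * X) - al * (Z - 1) * (q / (ka * Z)) * Y =
    - (al / ka) * Y * (qn (A * q * q) * qd / (A * q)).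
  rewrite hX' /qn /qd; field.
  by rewrite ?A0 ?Z1 ?q0 ?ka0 ?q2.
transitivity (A * q * ni1 / (qn (A * q * q) * al * qd) *
   (q ^+ 3 / M ^+ 2 * ka / Z * (al * (Z - 1) * X) - al * (Z - 1) * (q / (ka * Z)) * Y)); first by ring.
rewrite key; field; by rewrite ?A0 ?q0 ?ka0 ?m2 ?qd_neq0 ?al0.
Qed.

Lemma hpol_c : c = (q ^+ 3 / (q ^ n%:Z) ^+ 2 * ka + (q ^ n%:Z) ^+ 2 / q ^+ 3 / ka) / qd ^+ 2.
Proof.
have : hpol n = q ^+ 3 / (q ^ n%:Z) ^+ 2 * ka + (q ^ n%:Z) ^+ 2 / q ^+ 3 / ka - qd ^+ 2 * c.
  rewrite /hpol -/qd; congr (_ * _ + _ * _ - _).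
    have -> : 3%:Z - 2%:Z * n%:Z = 3 - (n%:Z + n%:Z) by lia.
    by rewrite expfzDr // -invr_expz expfzDr // expr2.
  have -> : 2%:Z * n%:Z - 3%:Z = (n%:Z + n%:Z) - 3 by lia.
  by rewrite expfzDr // expfzDr // expr2 -invr_expz.
rewrite hn => /esym/eqP; rewrite subr_eq0 => /eqP ->.
by rewrite mulrC mulKf // expf_neq0 ?qd_neq0.
Qed.

Lemma sing_out (a b k : int) : ~~ [&& 0 <= a, 0 <= b & a + b == n] -> sing a b k = 0.
Proof. by rewrite /sing; case: a => i //=; case: ifP => // ->. Qed.

Lemma sing_in (i j : nat) k : (i + j)%N = n -> sing i j k = sing_coef i k.
Proof. by move=> ij; rewrite /sing ifT //= -PoszD ij eqxx. Qed.

Lemma deg_sing : deg n sing.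
Proof. by move=> a b k ab; apply: sing_out; lia. Qed.

Lemma nz_sing : nz sing.
Proof. by exists 0, n%:Z, 0; rewrite (@sing_in 0) //= oner_neq0. Qed.

Lemma opE1_sing a b k : opE1 sing a b k = al * sing a b k.
Proof.
rewrite opE1E; have [/and3P[a0 b0 ab]|ab] := boolP [&& 0 <= a, 0 <= b & a + b == n]; last first.
  (* Just outside the quadrant, at b = -1, the factor [b+1] vanishes. *)
  rewrite (sing_out _ ab) ?mulr0 add0r; have [b1|b1] := eqVneq b (- 1).
    by rewrite b1 addNr qn0 !mul0r.
  by rewrite sing_out ?mulr0 //; lia.
case: a a0 ab => // i _ ab; case: b b0 ab => // j _ /eqP[ij].
rewrite (sing_in _ ij); case: i ij => [|i] ij.
  rewrite (@sing_out (0 - 1)) // mulr0 addr0 /=; have [->|_] := eqVneq k 0; last by rewrite !mulr0.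
  by rewrite expr0z mulr1.
have -> : i.+1%:Z - 1 = i by lia.
have -> : j%:Z + 1 = j.+1 by lia.
rewrite sing_in; last by lia.
have := sing_coefP i k.
have -> : q ^ n / q ^ i%:Z = q ^ j.+1%:Z.
  by rewrite -ij addSnnS addnC PoszD expfzDr // mulfK // expfz_neq0.
move=> E; apply/eqP; rewrite -subr_eq0; apply/eqP.
transitivity (al * (q ^ k - 1) * sing_coef i.+1 k - (- qn (q ^ j.+1) / ka * sing_coef i (k - 2))).
  by ring.
by rewrite E subrr.
Qed.

(** Criticality enters here: once c is replaced by its value in terms of ka, the equation is the
    recursion for index [i.+1] used at k - 1 and k + 1. On the boundary the factor [0] occurs. *)
Lemma opE2_sing a b k : opE2 sing a b k = 0.
Proof.
rewrite /opE2 !addr0.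
have [/and3P[a0 b0 ab]|ab] := boolP [&& 0 <= a + 1, 0 <= b + 1 & a + b + 1 == n]; last first.
  by rewrite !sing_out ?(mulr0, mul0r, subr0, addr0) //; lia.
have [a1|a1] := eqVneq a (-1).
  by rewrite a1 addNr qn0 !(@sing_out (-1)) ?(mulr0, mul0r, subr0, addr0) //; lia.
have [b1|b1] := eqVneq b (-1).
  by rewrite b1 addNr qn0 !(@sing_out _ (-1)) ?(mulr0, mul0r, subr0, addr0) //; lia.
case: a a0 ab a1 => [i|[|i]] // _ ab _; case: b b0 ab b1 => [j|[|j]] // _ ab _.
have ij : (i + j).+1 = n by lia.
have -> : i%:Z + 1 = i.+1 by lia.
have -> : j%:Z + 1 = j.+1 by lia.
rewrite !sing_in; try lia.
rewrite [sing_coef i.+1]/= hpol_c.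
have -> : k - 1 - 2 = k - 3 by lia.
have -> : k + 1 - 2 = k - 1 by lia.
have -> : q ^ n = q ^ i%:Z * q ^ j%:Z * q by rewrite -ij -addn1 !PoszD !expfzDr // expr1z.
have -> : q ^ i.+1%:Z = q ^ i%:Z * q by rewrite -addn1 PoszD expfzDr // expr1z.
have -> : q ^ j.+1%:Z = q ^ j%:Z * q by rewrite -addn1 PoszD expfzDr // expr1z.
have m0 : qn (q ^ i%:Z * q) != 0.
  by rewrite -[X in _ * X]expr1z -expfzDr // qn_neq0 //; lia.
rewrite !expfzDr // expr1z exprN1.
move: (expfz_neq0 i%:Z q0) (expfz_neq0 j%:Z q0) (expfz_neq0 k q0) m0.
move: (q ^ i) (q ^ j) (q ^ k) (sing_coef i (k - 1)) (sing_coef i (k + 1)) (sing_coef i (k - 3)).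
move=> A B Z X Y T A0 B0 Z0 m0.
have -> : A * B * q / A = B * q by field.
field.
by rewrite ?A0 ?B0 ?Z0 ?m0 ?qd_neq0 ?al0 ?ka0 ?q0.
Qed.

(** Each step of the recursion shifts k by 0 or 2. *)
Lemma sing_coef_supp i (k : int) : ~~ (0 <= k <= (i + i)%N%:Z) -> sing_coef i k = 0.
Proof.
elim: i k => [|i IH] k kn /=; first by case: eqVneq kn => // ->.
by rewrite !IH ?mulr0 ?subr0 ?mulr0 //; lia.
Qed.

(** These are the vectors K2^j w; linear combinations enter only in [singmod]. *)
Inductive kspan : vec -> Prop :=
| kspan_sing : kspan sing
| kspan_K2 x : kspan x -> kspan (opK2 x)
| kspan_K2i x : kspan x -> kspan (opK2i x).

(* Closing under F1 and F2 already gives a submodule: each K2^j w is an eigenvector of E1, is killed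
   by E2, and is sent by K1 to a multiple of K2^(j-2) w. *)
Inductive singmod : vec -> Prop :=
| singmod_kspan x : kspan x -> singmod x
| singmod_comb s t x y : singmod x -> singmod y -> singmod (comb s t x y)
| singmod_F1 x : singmod x -> singmod (opF1 x)
| singmod_F2 x : singmod x -> singmod (opF2 x)
| singmod_ext x y : (forall a b k, x a b k = y a b k) -> singmod x -> singmod y.

Lemma singmod_scale s x y : (forall a b k, y a b k = s * x a b k) -> singmod x -> singmod y.
Proof.
move=> E Sx; apply: singmod_ext (singmod_comb s 0 Sx Sx) => a b k.
by rewrite /comb mul0r addr0 E.
Qed.

Lemma kspan_deg x : kspan x -> deg n x.
Proof.
elim=> [|y _ dy|y _ dy] a b k ab; first exact: deg_sing.
  by rewrite /opK2 !addr0 dy ?mul0r.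
by rewrite /opK2i !addr0 dy ?mulr0.
Qed.

Lemma kspan_E1 x : kspan x -> exists l, forall a b k, opE1 x a b k = l * x a b k.
Proof.
elim=> [|y _ [l El]|y _ [l El]]; first by exists al; apply: opE1_sing.
  by exists (q * l) => a b k; rewrite opE1K2 /opK2 El; ring.
by exists (q^-1 * l) => a b k; rewrite opE1K2i /opK2i El; ring.
Qed.

Lemma kspan_E2 x : kspan x -> forall a b k, opE2 x a b k = 0.
Proof.
elim=> [|y _ Ey|y _ Ey] a b k; first exact: opE2_sing.
  by rewrite opE2K2 /opK2 Ey mul0r mulr0.
by rewrite opE2K2i /opK2i Ey !mulr0.
Qed.

(** Induction on membership. The K_i commute with the F_j up to scalars, and E_i commutes with F_j
    up to a combination of K_i and its inverse, so the K-letters are treated first. *)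
Lemma singmod_op l x : singmod x -> singmod (op l x).
Proof.
have comb1 s t z y y' : singmod y -> singmod y' ->
    (forall a b k, z a b k = s * y a b k + t * y' a b k) -> singmod z.
  by move=> Sy Sy' E; apply: singmod_ext (singmod_comb s t Sy Sy') => a b k; rewrite /comb E.
have ext l' y z : (forall a b k, y a b k = z a b k) -> forall a b k, op l' z a b k = op l' y a b k.
  move=> E a b k; case: l'; rewrite /= /opE1 /opE2 /opF1 /opF2 /opK1 /opK1i /opK2 /opK2i !E //.
have K1S y : singmod y -> singmod (opK1 y).
  elim=> {y} [y ky|s t y z _ Sy _ Sz|y _ Sy|y _ Sy|y z E _ Sy].
  (* In degree n the element K = K1 K2^2 is the scalar ka q^(-3n), so K1 is this multiple of
     K2^-2. *)
  - apply: (@singmod_scale (ka * (q ^ n) ^- 3) (opK2i (opK2i y))) => [a b k|]; last first.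
      by apply/singmod_kspan/kspan_K2i/kspan_K2i.
    have [ab|ab] := eqVneq (a + b) n; last first.
      by rewrite /opK1 /opK2i !addr0 !(kspan_deg ky) ?mulr0.
    rewrite -ab; qfield y a b k.
  - by apply: (comb1 s t _ _ _ Sy Sz) => a b k; apply: (op_comb lK1).
  - by apply: singmod_scale (singmod_F1 Sy) => a b k; apply: opK1F1.
  - by apply: singmod_scale (singmod_F2 Sy) => a b k; apply: opK1F2.
  - by apply: singmod_ext Sy => a b k; apply/esym/(ext lK1 _ _ E).
have K1iS y : singmod y -> singmod (opK1i y).
  elim=> {y} [y ky|s t y z _ Sy _ Sz|y _ Sy|y _ Sy|y z E _ Sy].
  - apply: (@singmod_scale (ka^-1 * (q ^ n) ^+ 3) (opK2 (opK2 y))) => [a b k|]; last first.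
      by apply/singmod_kspan/kspan_K2/kspan_K2.
    have [ab|ab] := eqVneq (a + b) n; last first.
      by rewrite /opK1i /opK2 !addr0 !(kspan_deg ky) ?(mulr0, mul0r).
    rewrite -ab; qfield y a b k.
  - by apply: (comb1 s t _ _ _ Sy Sz) => a b k; apply: (op_comb lK1i).
  - by apply: singmod_scale (singmod_F1 Sy) => a b k; apply: opK1iF1.
  - by apply: singmod_scale (singmod_F2 Sy) => a b k; apply: opK1iF2.
  - by apply: singmod_ext Sy => a b k; apply/esym/(ext lK1i _ _ E).
have K2S y : singmod y -> singmod (opK2 y).
  elim=> {y} [y ky|s t y z _ Sy _ Sz|y _ Sy|y _ Sy|y z E _ Sy].
  - exact/singmod_kspan/kspan_K2.
  - by apply: (comb1 s t _ _ _ Sy Sz) => a b k; apply: (op_comb lK2).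
  - by apply: singmod_scale (singmod_F1 Sy) => a b k; apply: opK2F1.
  - by apply: singmod_scale (singmod_F2 Sy) => a b k; apply: opK2F2.
  - by apply: singmod_ext Sy => a b k; apply/esym/(ext lK2 _ _ E).
have K2iS y : singmod y -> singmod (opK2i y).
  elim=> {y} [y ky|s t y z _ Sy _ Sz|y _ Sy|y _ Sy|y z E _ Sy].
  - exact/singmod_kspan/kspan_K2i.
  - by apply: (comb1 s t _ _ _ Sy Sz) => a b k; apply: (op_comb lK2i).
  - by apply: singmod_scale (singmod_F1 Sy) => a b k; apply: opK2iF1.
  - by apply: singmod_scale (singmod_F2 Sy) => a b k; apply: opK2iF2.
  - by apply: singmod_ext Sy => a b k; apply/esym/(ext lK2i _ _ E).
have diff t y z z' : singmod y -> singmod z -> singmod z' ->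
    (forall a b k, t a b k - y a b k = (z a b k - z' a b k) / qd) -> singmod t.
  move=> Sy Sz Sz' E; apply: (comb1 1 1 _ y (comb qd^-1 (- qd^-1) z z')) => //.
    exact: singmod_comb.
  move=> a b k; rewrite /comb -[t a b k](subrK (y a b k)) E; ring.
case: l => Sx; rewrite /=; [ | | exact: singmod_F1 | exact: singmod_F2 | exact: K1S | exact: K1iS
  | exact: K2S | exact: K2iS]; elim: Sx => {x} [y ky|s t y z _ Sy _ Sz|y Sy Ey|y Sy Ey|y z E _ Sy].
- have [l El] := kspan_E1 ky; exact: singmod_scale El (singmod_kspan ky).
- by apply: (comb1 s t _ _ _ Sy Sz) => a b k; apply: (op_comb lE1).
- by apply: (diff _ _ _ _ (singmod_F1 Ey) (K1S _ Sy) (K1iS _ Sy)) => a b k; apply: opE1F1.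
- apply: singmod_ext (singmod_F2 Ey) => a b k.
  by apply/esym/eqP; rewrite -subr_eq0 opE1F2.
- by apply: singmod_ext Sy => a b k; apply/esym/(ext lE1 _ _ E).
- apply: (@singmod_scale 0 y) (singmod_kspan ky) => a b k.
  by rewrite (kspan_E2 ky) mul0r.
- by apply: (comb1 s t _ _ _ Sy Sz) => a b k; apply: (op_comb lE2).
- apply: singmod_ext (singmod_F1 Ey) => a b k.
  by apply/esym/eqP; rewrite -subr_eq0 opE2F1.
- by apply: (diff _ _ _ _ (singmod_F2 Ey) (K2S _ Sy) (K2iS _ Sy)) => a b k; apply: opE2F2.
- by apply: singmod_ext Sy => a b k; apply/esym/(ext lE2 _ _ E).
Qed.

(** F1 preserves a + b and F2 raises it by one, so nothing below the degree of w is reached. *)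
Lemma singmod_low x : singmod x -> forall a b k : int, a + b < n%:Z -> x a b k = 0.
Proof.
elim=> {x} [y ky|s t y z _ Ey _ Ez|y _ Ey|y _ Ey|y z E _ Ey] a b k ab.
- by apply: (kspan_deg ky); lia.
- by rewrite /comb Ey // Ez // !mulr0 addr0.
- by rewrite /opF1 !Ey ?(mulr0, addr0, oppr0, mul0r) //; lia.
- by rewrite /opF2 Ey //; lia.
- by rewrite -E Ey.
Qed.

End Critical.
End Model.

(** * The free algebra modulo W *)

(* Otherwise simplification exposes complex R, whose canonical structures are not inferred here. *)
Opaque C.

(** A form of multiplication by a generator that computes on words. *)
Definition lmul (l : letter) (f : ncpoly) : ncpoly :=
  fun w => if w is l' :: w' then if l' == l then f w' else 0 else 0.

(** Only the cut just after the prefix [u] contributes to the convolution. *)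
Lemma pmul_mono u f : pmul (mono u) f = foldr lmul f u.
Proof.
apply: functional_extensionality; rewrite /pmul /mono; elim: u => [|l u IH] w /=.
  rewrite big_ord_recl /= take0 eqxx mul1r drop0 big1 ?addr0 // => i _.
  by case: w i => [[]|l w] i //=; rewrite mul0r.
case: w => [|l' w] /=; first by rewrite big_ord1 mul0r.
rewrite big_ord_recl /= mul0r add0r.
case: eqVneq => [->|ne]; last by rewrite big1 // => i _; rewrite eqseq_cons (negPf ne) mul0r.
by rewrite -IH; apply: eq_bigr => i _; rewrite /= eqseq_cons eqxx.
Qed.

Lemma pmul_gen l f : pmul (gen l) f = lmul l f.
Proof. exact: pmul_mono. Qed.

Ltac pointwise := apply: functional_extensionality => ?; rewrite /psub /padd /pscale /pzero.

Lemma pmulDl f g h : pmul (padd f g) h = padd (pmul f h) (pmul g h).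
Proof. by pointwise; rewrite /pmul -big_split; apply: eq_bigr => i _ /=; ring. Qed.
Lemma pmulZl a f h : pmul (pscale a f) h = pscale a (pmul f h).
Proof. by pointwise; rewrite /pmul mulr_sumr; apply: eq_bigr => i _ /=; ring. Qed.
Lemma pmulBl f g h : pmul (psub f g) h = psub (pmul f h) (pmul g h).
Proof. by rewrite /psub pmulDl pmulZl. Qed.
Lemma pmulDr f g h : pmul h (padd f g) = padd (pmul h f) (pmul h g).
Proof. by pointwise; rewrite /pmul -big_split; apply: eq_bigr => i _ /=; ring. Qed.
Lemma pmulZr a f h : pmul h (pscale a f) = pscale a (pmul h f).
Proof. by pointwise; rewrite /pmul mulr_sumr; apply: eq_bigr => i _ /=; ring. Qed.
Lemma pmul0r h : pmul h pzero = pzero.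
Proof. by pointwise; rewrite /pmul big1 // => i _; rewrite mulr0. Qed.

Lemma lmulD l f g : lmul l (padd f g) = padd (lmul l f) (lmul l g).
Proof. by rewrite -!pmul_gen pmulDr. Qed.
Lemma lmulZ l a f : lmul l (pscale a f) = pscale a (lmul l f).
Proof. by rewrite -!pmul_gen pmulZr. Qed.
Lemma lmul0 l : lmul l pzero = pzero.
Proof. by rewrite -!pmul_gen pmul0r. Qed.
Lemma lmulB l f g : lmul l (psub f g) = psub (lmul l f) (lmul l g).
Proof. by rewrite /psub lmulD lmulZ. Qed.
Lemma lmul_mono l w : lmul l (mono w) = mono (l :: w).
Proof. 
apply: functional_extensionality => -[|l' v] //=; rewrite /mono eqseq_cons.
by case: eqVneq.
Qed.

Lemma Falg_lmul l f : Falg f -> Falg (lmul l f).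
Proof.
elim=> [|_ [w ->]|? ? _ IHf _ IHg|? ? _ IHf].
- by rewrite lmul0; apply: lspan0.
- by rewrite lmul_mono; apply: lspan_gen; exists (l :: w).
- by rewrite lmulD; apply: lspan_add.
- by rewrite lmulZ; apply: lspan_scale.
Qed.

Lemma Falg_mono w : Falg (mono w).
Proof. by apply: lspan_gen; exists w. Qed.

Lemma lspan_sub S f g : lspan S f -> lspan S g -> lspan S (psub f g).
Proof. by move=> Sf Sg; apply/lspan_add/lspan_scale. Qed.

Lemma lspan_mono (S S' : ncpoly -> Prop) f : (forall g, S g -> lspan S' g) -> lspan S f -> lspan S' f.
Proof.
move=> SS'; elim=> [|? /SS' //|? ? _ ? _ ?|? ? _ ?]; first exact: lspan0.
- exact: lspan_add.
- exact: lspan_scale.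
Qed.

Lemma Falg_fin f : Falg f -> fin_supp f.
Proof.
elim=> [|_ [w ->]|g h _ fg _ fh|a g _ fg].
- by exists [::].
- exact: fin_supp_single.
- have := fin_supp_comb 1 1 fg fh; congr fin_supp.
  by apply: functional_extensionality => i; rewrite !mul1r.
- have := fin_supp_comb a 0 fg fg; congr fin_supp.
  by apply: functional_extensionality => i; rewrite mul0r addr0.
Qed.

(** * Congruence modulo W *)

Section Quotient.
Variables q al ka c : C.
Hypotheses (q0 : q != 0) (nonroot : forall n : nat, (0 < n)%N -> q ^+ n != 1).
Hypotheses (al0 : al != 0) (ka0 : ka != 0).

Local Notation W := (lspan (Wgens q al ka c)).

Lemma W_lmul l f : W f -> W (lmul l f).
Proof.
elim=> [|g Wg|? ? _ IHf _ IHg|? ? _ IHf].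
- by rewrite lmul0; apply: lspan0.
- apply: lspan_gen; case: Wg => [[[u [v [r [ur ->]]]]|[u [w [ew ->]]]]|[[u ->]|[u ->]]].
  + by left; left; exists (l :: u), v, r; rewrite !pmul_mono.
  + by left; right; exists (l :: u), w; rewrite !pmul_mono.
  + by right; left; exists (l :: u); rewrite !pmul_mono.
  + by right; right; exists (l :: u); rewrite !pmul_mono.
- by rewrite lmulD; apply: lspan_add.
- by rewrite lmulZ; apply: lspan_scale.
Qed.

(** The ideal generators carry a word on the right; linearity replaces this word by any [x]. *)
Lemma W_rel r x : Uq_rel q r -> Falg x -> W (pmul r x).
Proof.
move=> rr; elim=> [|_ [v ->]|? ? _ IHf _ IHg|? ? _ IHf].
- by rewrite pmul0r; apply: lspan0.
- apply: lspan_gen; left; left; exists [::], v, r; split=> //.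
  by rewrite [in RHS]pmul_mono.
- by rewrite pmulDr; apply: lspan_add.
- by rewrite pmulZr; apply: lspan_scale.
Qed.

Definition eqW (f g : ncpoly) := W (psub f g).

Lemma eqW_refl f : eqW f f.
Proof. by rewrite /eqW (_ : psub f f = pzero); [exact: lspan0 | pointwise; ring]. Qed.
Lemma eqW_sym f g : eqW f g -> eqW g f.
Proof.
move=> H; rewrite /eqW (_ : psub g f = pscale (-1) (psub f g)); first exact: lspan_scale.
by pointwise; ring.
Qed.
Lemma eqW_trans f g h : eqW f g -> eqW g h -> eqW f h.
Proof.
move=> H H'; rewrite /eqW (_ : psub f h = padd (psub f g) (psub g h)); first exact: lspan_add.
by pointwise; ring.
Qed.

#[local] Instance eqW_equiv : Equivalence eqW.
Proof. by split; [exact: eqW_refl | exact: eqW_sym | exact: eqW_trans]. Qed.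
#[local] Instance padd_eqW : Proper (eqW ==> eqW ==> eqW) padd.
Proof.
move=> f f' E g g' E'; rewrite /eqW.
rewrite (_ : psub _ _ = padd (psub f f') (psub g g')); first exact: lspan_add.
by pointwise; ring.
Qed.
#[local] Instance pscale_eqW a : Proper (eqW ==> eqW) (pscale a).
Proof.
move=> f f' E; rewrite /eqW (_ : psub _ _ = pscale a (psub f f')); first exact: lspan_scale.
by pointwise; ring.
Qed.
#[local] Instance psub_eqW : Proper (eqW ==> eqW ==> eqW) psub.
Proof. by move=> f f' E g g' E'; apply: padd_eqW => //; apply: pscale_eqW. Qed.
#[local] Instance lmul_eqW l : Proper (eqW ==> eqW) (lmul l).
Proof. by move=> f f' E; rewrite /eqW -lmulB; apply: W_lmul. Qed.

Lemma eqW_move f g h : W (psub (psub f g) h) -> eqW f (padd g h).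
Proof. by rewrite /eqW => H; rewrite (_ : psub f _ = psub (psub f g) h) //; pointwise; ring. Qed.

(** * The defining relations as congruences *)

Section Relations.
Variable x : ncpoly.
Hypothesis Fx : Falg x.
Hint Resolve Fx Falg_lmul : core.

Lemma relKKi i : eqW (lmul (lK i) (lmul (lKi i) x)) x.
Proof.
have /W_rel/(_ Fx) : Uq_rel q (psub (pmul (gen (lK i)) (gen (lKi i))) (mono [::])) by left; exists i.
by rewrite pmulBl pmul_gen lmul_mono !pmul_mono.
Qed.

Lemma relKiK i : eqW (lmul (lKi i) (lmul (lK i) x)) x.
Proof.
have /W_rel/(_ Fx) : Uq_rel q (psub (pmul (gen (lKi i)) (gen (lK i))) (mono [::])) by right; left; exists i.
by rewrite pmulBl pmul_gen lmul_mono !pmul_mono.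
Qed.

Lemma relKK : eqW (lmul lK1 (lmul lK2 x)) (lmul lK2 (lmul lK1 x)).
Proof.
have /W_rel/(_ Fx) : Uq_rel q (psub (pmul (gen lK1) (gen lK2)) (pmul (gen lK2) (gen lK1))) by right; right; left.
by rewrite pmulBl !pmul_gen !lmul_mono !pmul_mono.
Qed.

Lemma relEF i j : eqW (lmul (lE i) (lmul (lF j) x)) (padd (lmul (lF j) (lmul (lE i) x))
  (pscale ((i == j)%:R / (q - q^-1)) (psub (lmul (lK i) x) (lmul (lKi i) x)))).
Proof.
apply: eqW_move; have /W_rel/(_ Fx) : Uq_rel q (psub (psub (pmul (gen (lE i)) (gen (lF j)))
                                 (pmul (gen (lF j)) (gen (lE i))))
                           (pscale ((i == j)%:R / (q - q^-1))
                                   (psub (gen (lK i)) (gen (lKi i))))) by right; right; right; left; exists i, j.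
by rewrite !(pmulBl, pmulZl) !pmul_gen !lmul_mono !pmul_mono.
Qed.

Lemma relKE i j : eqW (lmul (lK i) (lmul (lE j) (lmul (lKi i) x))) (pscale (q ^ cartan i j) (lmul (lE j) x)).
Proof.
have /W_rel/(_ Fx) : Uq_rel q (psub (pmul (gen (lK i)) (pmul (gen (lE j)) (gen (lKi i))))
                           (pscale (q ^ cartan i j) (gen (lE j)))) by do 4!right; left; exists i, j.
by rewrite !(pmulBl, pmulZl) !pmul_gen !lmul_mono !pmul_mono.
Qed.

Lemma relKF i j : eqW (lmul (lK i) (lmul (lF j) (lmul (lKi i) x))) (pscale (q ^ (- cartan i j)) (lmul (lF j) x)).
Proof.
have /W_rel/(_ Fx) : Uq_rel q (psub (pmul (gen (lK i)) (pmul (gen (lF j)) (gen (lKi i))))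
                           (pscale (q ^ (- cartan i j)) (gen (lF j)))) by do 5!right; left; exists i, j.
by rewrite !(pmulBl, pmulZl) !pmul_gen !lmul_mono !pmul_mono.
Qed.

Lemma relFF i j : i != j -> W (padd (psub (lmul (lF i) (lmul (lF i) (lmul (lF j) x)))
     (pscale (q + q^-1) (lmul (lF i) (lmul (lF j) (lmul (lF i) x)))))
   (lmul (lF j) (lmul (lF i) (lmul (lF i) x)))).
Proof.
move=> ij; have /W_rel/(_ Fx) : Uq_rel q (padd (psub (mono [:: lF i; lF i; lF j])
                       (pscale (q + q^-1) (mono [:: lF i; lF j; lF i])))
                 (mono [:: lF j; lF i; lF i])) by do 7!right; exists i, j.
by rewrite !(pmulBl, pmulZl, pmulDl) !pmul_mono.
Qed.
End Relations.

Lemma Falg_pmul u h : Falg h -> Falg (pmul (mono u) h).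
Proof. by rewrite pmul_mono => Fh; elim: u => //= l u; apply: Falg_lmul. Qed.

Lemma Falg_rel r v : Uq_rel q r -> Falg (pmul r (mono v)).
Proof.
move=> rr; suff: Falg r.
  elim=> [|_ [w ->]|? ? _ IHf _ IHg|? ? _ IHf]; rewrite ?pmulDl ?pmulZl.
  - rewrite (_ : pmul _ _ = pzero); first exact: lspan0.
    by pointwise; rewrite /pmul big1 // => i _; rewrite mul0r.
  - exact/Falg_pmul/Falg_mono.
  - exact: lspan_add.
  - exact: lspan_scale.
case: rr => [[i]|[[i]|[|[[i [j]]|[[i [j]]|[[i [j]]|[[i [j [_]]]|[i [j [_]]]]]]]]]] ->;
repeat first [exact: Falg_mono | apply: Falg_pmul | apply: lspan_sub | apply: lspan_add | apply: lspan_scale].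
Qed.

Lemma Falg_pconst a : Falg (pconst a).
Proof. exact/lspan_scale/Falg_mono. Qed.

Lemma Falg_C1el : Falg (C1el q).
Proof.
apply: lspan_add; first exact: Falg_mono.
by apply/lspan_scale/lspan_add; apply/lspan_scale/Falg_mono.
Qed.

Lemma W_Falg f : W f -> Falg f.
Proof.
apply: lspan_mono => g [[[u [v [r [rr ->]]]]|[u [w [_ ->]]]]|[[u ->]|[u ->]]]; apply: Falg_pmul.
- exact: Falg_rel.
- exact: lspan_sub (Falg_mono _) (Falg_pconst _).
- exact: lspan_sub (Falg_mono _) (Falg_pconst _).
- exact: lspan_sub Falg_C1el (Falg_pconst _).
Qed.

Lemma Falg_padd f g : Falg f -> Falg g -> Falg (padd f g).
Proof. exact: lspan_add. Qed.
Lemma Falg_pscale a f : Falg f -> Falg (pscale a f).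
Proof. exact: lspan_scale. Qed.
Lemma Falg_psub f g : Falg f -> Falg g -> Falg (psub f g).
Proof. exact: lspan_sub. Qed.

Hint Resolve Falg_lmul Falg_mono Falg_padd Falg_pscale Falg_psub : core.

(** * Commuting the K_i past other letters *)

Section Conjugation.
Variables (k k' l : letter) (s : C).
Hypothesis s0 : s != 0.
Hypothesis kk' : forall x, Falg x -> eqW (lmul k (lmul k' x)) x.
Hypothesis k'k : forall x, Falg x -> eqW (lmul k' (lmul k x)) x.
Hypothesis klk : forall x, Falg x -> eqW (lmul k (lmul l (lmul k' x))) (pscale s (lmul l x)).

Lemma conj_left x : Falg x -> eqW (lmul k (lmul l x)) (pscale s (lmul l (lmul k x))).
Proof. by move=> Fx; rewrite -(klk (Falg_lmul k Fx)) (k'k Fx); reflexivity. Qed.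

Lemma pscaleK a x : a != 0 -> pscale a^-1 (pscale a x) = x.
Proof. by move=> a0; pointwise; rewrite mulKf. Qed.

Lemma conj_right x : Falg x -> eqW (lmul l (lmul k x)) (pscale s^-1 (lmul k (lmul l x))).
Proof. by move=> Fx; rewrite (conj_left Fx) pscaleK //; reflexivity. Qed.

Lemma conj_left' x : Falg x -> eqW (lmul k' (lmul l x)) (pscale s^-1 (lmul l (lmul k' x))).
Proof.
move=> Fx; have /(lmul_eqW k') := klk Fx; rewrite lmulZ => E.
by rewrite -(k'k (Falg_lmul l (Falg_lmul k' Fx))) E pscaleK //; reflexivity.
Qed.

Lemma conj_right' x : Falg x -> eqW (lmul l (lmul k' x)) (pscale s (lmul k' (lmul l x))).
Proof.
by move=> Fx; rewrite (conj_left' Fx) -{1}[s]invrK pscaleK ?invr_neq0 //; reflexivity.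
Qed.
End Conjugation.

(** * Spanning families of the quotient *)

Definition Sp (A : ncpoly -> Prop) := lspan (fun f => Wgens q al ka c f \/ A f).

Lemma Sp_in (A : ncpoly -> Prop) f : A f -> Sp A f.
Proof. by move=> Af; apply: lspan_gen; right. Qed.

Lemma Sp_W A f : W f -> Sp A f.
Proof. by apply: lspan_mono => g Wg; apply: lspan_gen; left. Qed.

Lemma Sp_eqW A f g : eqW f g -> Sp A g -> Sp A f.
Proof.
move=> E Ag; rewrite (_ : f = padd (psub f g) g); last by pointwise; ring.
by apply: lspan_add => //; apply: Sp_W.
Qed.

Lemma Sp_lmul (A B : ncpoly -> Prop) l :
  (forall x, A x -> Sp B (lmul l x)) -> forall x, Sp A x -> Sp B (lmul l x).
Proof.
move=> AB x; elim=> [|g [Wg|/AB //]|? ? _ IHf _ IHg|? ? _ IHf].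
- by rewrite lmul0; apply: lspan0.
- by apply/Sp_W/W_lmul/lspan_gen.
- by rewrite lmulD; apply: lspan_add.
- by rewrite lmulZ; apply: lspan_scale.
Qed.

Lemma Sp_sub (A B : ncpoly -> Prop) : (forall x, A x -> Sp B x) -> forall x, Sp A x -> Sp B x.
Proof.
move=> AB; have H g : Wgens q al ka c g \/ A g -> Sp B g.
  by case=> [Wg|/AB //]; apply/Sp_W/lspan_gen.
by move=> x; apply: lspan_mono.
Qed.

Definition one : ncpoly := mono [::].

(** The top layer of vectors K2^k v. Further down, [fw] puts arbitrary words in F1, F2 in front, and
    [f23w] only the ordered products F2^a F3^b. *)
Inductive kw : ncpoly -> Prop :=
| kw_one : kw one
| kw_K2 x : kw x -> kw (lmul lK2 x)
| kw_K2i x : kw x -> kw (lmul lK2i x).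

Inductive fw : ncpoly -> Prop :=
| fw_kw x : kw x -> fw x
| fw_F j x : fw x -> fw (lmul (lF j) x).

Definition F3 (x : ncpoly) := psub (lmul lF1 (lmul lF2 x)) (pscale q (lmul lF2 (lmul lF1 x))).

Inductive f3w : ncpoly -> Prop :=
| f3w_kw x : kw x -> f3w x
| f3w_F3 x : f3w x -> f3w (F3 x).

Inductive f23w : ncpoly -> Prop :=
| f23w_f3w x : f3w x -> f23w x
| f23w_F2 x : f23w x -> f23w (lmul lF2 x).

Lemma kw_Falg x : kw x -> Falg x.
Proof. by elim=> [|y _ Fy|y _ Fy]; [exact: Falg_mono | exact: Falg_lmul | exact: Falg_lmul]. Qed.

Lemma fw_Falg x : fw x -> Falg x.
Proof. by elim=> [y /kw_Falg|j y _ Fy] //; apply: Falg_lmul. Qed.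

Lemma F3_Falg x : Falg x -> Falg (F3 x).
Proof. by move=> Fx; rewrite /F3; auto 6. Qed.

Lemma f23w_Falg x : f23w x -> Falg x.
Proof.
elim=> [y|y _ Fy]; last exact: Falg_lmul.
by elim=> [z /kw_Falg|z _ Fz] //; apply: F3_Falg.
Qed.

(** The letter is moved through the word in K2 and its inverse until it reaches the generator. *)
Lemma kw_closed l s s' : Sp kw (lmul l one) ->
    (forall x, Falg x -> eqW (lmul l (lmul lK2 x)) (pscale s (lmul lK2 (lmul l x)))) ->
    (forall x, Falg x -> eqW (lmul l (lmul lK2i x)) (pscale s' (lmul lK2i (lmul l x)))) ->
  forall x, kw x -> Sp kw (lmul l x).
Proof.
move=> l1 lK lK'; have cK x : Sp kw x -> Sp kw (lmul lK2 x).
  by apply: Sp_lmul => y ky; apply/Sp_in/kw_K2.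
have cK' x : Sp kw x -> Sp kw (lmul lK2i x).
  by apply: Sp_lmul => y ky; apply/Sp_in/kw_K2i.
move=> x; elim=> {x} [|x /kw_Falg kx lx|x /kw_Falg kx lx]; first exact: l1.
  by apply: Sp_eqW (lK _ kx) _; apply/lspan_scale/cK.
by apply: Sp_eqW (lK' _ kx) _; apply/lspan_scale/cK'.
Qed.

Lemma K_one : eqW (lmul lK1 (lmul lK2 (lmul lK2 one))) (pscale ka one).
Proof.
rewrite !lmul_mono; apply: lspan_gen; right; left; exists [::].
by rewrite pmul_mono.
Qed.

Lemma E1_one : eqW (lmul lE1 one) (pscale al one).
Proof.
rewrite lmul_mono; apply: lspan_gen; left; right; exists [::], [:: lE1]; split=> //.
by rewrite pmul_mono /pconst /eta_word /= expr1.
Qed.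

Lemma E2_one : eqW (lmul lE2 one) (pscale 0 one).
Proof.
rewrite lmul_mono; apply: lspan_gen; left; right; exists [::], [:: lE2]; split=> //.
by rewrite pmul_mono.
Qed.

Lemma C1_one : eqW (padd (lmul lF1 (lmul lE1 one)) (pscale ((q - q^-1) ^+ 2)^-1
  (padd (pscale q (lmul lK1 one)) (pscale q^-1 (lmul lK1i one))))) (pscale c one).
Proof.
rewrite !lmul_mono; apply: lspan_gen; right; right; exists [::].
by rewrite pmul_mono.
Qed.

Lemma commK1K2 x : Falg x -> eqW (lmul lK1 (lmul lK2 x)) (pscale 1 (lmul lK2 (lmul lK1 x))).
Proof. by move=> Fx; rewrite relKK // (_ : pscale 1 _ = lmul lK2 (lmul lK1 x)); [reflexivity|pointwise; ring]. Qed.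

Let o0 : (1 : C) != 0 := oner_neq0 _.
Let KKi i x (Fx : Falg x) := relKKi Fx i.
Let KiK i x (Fx : Falg x) := relKiK Fx i.

Lemma scale1 x : pscale 1 x = x.
Proof. by pointwise; rewrite mul1r. Qed.

(** Presenting the commutation of K1 and K2 as conjugation with scalar 1 lets the conjugation lemmas
    supply the commutations with the inverses. *)
Lemma conjK2K1 x : Falg x -> eqW (lmul lK2 (lmul lK1 (lmul lK2i x))) (pscale 1 (lmul lK1 x)).
Proof.
by move=> Fx; rewrite -(relKK (Falg_lmul lK2i Fx)) (KKi true Fx) scale1; reflexivity.
Qed.

Lemma conjK1K2 x : Falg x -> eqW (lmul lK1 (lmul lK2 (lmul lK1i x))) (pscale 1 (lmul lK2 x)).
Proof.
by move=> Fx; rewrite (relKK (Falg_lmul lK1i Fx)) (KKi false Fx) scale1; reflexivity.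
Qed.

Lemma commK1K2i x : Falg x -> eqW (lmul lK1 (lmul lK2i x)) (pscale 1 (lmul lK2i (lmul lK1 x))).
Proof. exact: (conj_right' o0 (KiK true) conjK2K1). Qed.

Lemma commK1iK2 x : Falg x -> eqW (lmul lK1i (lmul lK2 x)) (pscale 1^-1 (lmul lK2 (lmul lK1i x))).
Proof. exact: (conj_left' o0 (KiK false) conjK1K2). Qed.

Lemma conjK2K1i x : Falg x -> eqW (lmul lK2 (lmul lK1i (lmul lK2i x))) (pscale 1 (lmul lK1i x)).
Proof.
move=> Fx; have := commK1iK2 (Falg_lmul lK2i Fx); rewrite (KKi true Fx) invr1 !scale1 => <-.
reflexivity.
Qed.

Lemma commK1iK2i x : Falg x -> eqW (lmul lK1i (lmul lK2i x)) (pscale 1 (lmul lK2i (lmul lK1i x))).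
Proof. exact: (conj_right' o0 (KiK true) conjK2K1i). Qed.

Let F1s : Falg one := Falg_mono _.

Lemma kw_K1 x : kw x -> Sp kw (lmul lK1 x).
Proof.
apply: (kw_closed _ commK1K2 commK1K2i).
(* From K1 K2^2 v = ka v one gets K1 v = ka K2^-2 v. *)
apply: (Sp_eqW (g := pscale ka (lmul lK2i (lmul lK2i one)))); last first.
  by apply/lspan_scale/Sp_in/kw_K2i/kw_K2i/kw_one.
have FK1 := Falg_lmul lK1 F1s.
rewrite -!lmulZ -K_one (relKK (Falg_lmul lK2 F1s)) (relKK F1s).
by rewrite (KiK true (Falg_lmul lK2 FK1)) (KiK true FK1); reflexivity.
Qed.

Lemma kw_K1i x : kw x -> Sp kw (lmul lK1i x).
Proof.
apply: (kw_closed _ commK1iK2 commK1iK2i).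
apply: (Sp_eqW (g := pscale ka^-1 (lmul lK2 (lmul lK2 one)))); last first.
  by apply/lspan_scale/Sp_in/kw_K2/kw_K2/kw_one.
rewrite -(KiK false (Falg_lmul lK2 (Falg_lmul lK2 F1s))) K_one lmulZ pscaleK //; reflexivity.
Qed.

Let qz (i : int) : q ^ i != 0.
Proof. exact: expfz_neq0. Qed.

Lemma kw_E j x : kw x -> Sp kw (lmul (lE j) x).
Proof.
have rel y (Fy : Falg y) := relKE Fy true j.
apply: (kw_closed _ (conj_right (qz _) (KiK true) rel) (conj_right' (qz _) (KiK true) rel)).
by case: j {rel}; [apply: Sp_eqW E2_one _ | apply: Sp_eqW E1_one _]; apply/lspan_scale/Sp_in/kw_one.
Qed.

(** F1 v = al^-1 F1 E1 v, and C1 v = c v expresses F1 E1 v through v and K1^(+-1) v. *)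
Lemma kw_F1 x : kw x -> Sp kw (lmul lF1 x).
Proof.
have rel y (Fy : Falg y) := relKF Fy true false.
apply: (kw_closed _ (conj_right (qz _) (KiK true) rel) (conj_right' (qz _) (KiK true) rel)).
have : Sp kw (lmul lF1 (lmul lE1 one)).
  have E := C1_one.
  rewrite (_ : lmul lF1 _ = psub (padd (lmul lF1 (lmul lE1 one)) (pscale ((q - q^-1) ^+ 2)^-1
    (padd (pscale q (lmul lK1 one)) (pscale q^-1 (lmul lK1i one)))))
    (pscale ((q - q^-1) ^+ 2)^-1 (padd (pscale q (lmul lK1 one)) (pscale q^-1 (lmul lK1i one)))));
    last by pointwise; ring.
  apply: lspan_sub; first by apply: Sp_eqW C1_one _; apply/lspan_scale/Sp_in/kw_one.
  apply/lspan_scale/lspan_add; apply: lspan_scale; [apply: kw_K1 | apply: kw_K1i]; exact: kw_one.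
move=> H; apply: (Sp_eqW (g := pscale al^-1 (lmul lF1 (lmul lE1 one)))); last exact: lspan_scale.
by rewrite E1_one lmulZ pscaleK //; reflexivity.
Qed.

Lemma Spfw_F j x : Sp fw x -> Sp fw (lmul (lF j) x).
Proof. by apply: Sp_lmul => y fy; apply/Sp_in/fw_F. Qed.

Lemma Spfw_K l (s : bool -> C) : (forall x, kw x -> Sp kw (lmul l x)) ->
    (forall j x, Falg x -> eqW (lmul l (lmul (lF j) x)) (pscale (s j) (lmul (lF j) (lmul l x)))) ->
  forall x, Sp fw x -> Sp fw (lmul l x).
Proof.
move=> kl E; apply: Sp_lmul => x; elim=> {x} [x kx|j x fx IH].
  by apply: Sp_sub (kl _ kx) => y ky; apply/Sp_in/fw_kw.
by apply: Sp_eqW (E j x (fw_Falg fx)) _; apply/lspan_scale/Spfw_F.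
Qed.

Lemma SpfwK i x : Sp fw x -> Sp fw (lmul (lK i) x).
Proof.
apply: Spfw_K => [y ky|j y]; first by case: i; [apply/Sp_in/kw_K2|exact: kw_K1].
exact: (conj_left (KiK i) (fun x Fx => relKF Fx i j)).
Qed.

Lemma SpfwKi i x : Sp fw x -> Sp fw (lmul (lKi i) x).
Proof.
apply: Spfw_K => [y ky|j y]; first by case: i; [apply/Sp_in/kw_K2i|exact: kw_K1i].
exact: (conj_left' (qz _) (KiK i) (fun x Fx => relKF Fx i j)).
Qed.

Lemma SpfwE i x : Sp fw x -> Sp fw (lmul (lE i) x).
Proof.
apply: Sp_lmul => {}x; elim=> {x} [x kx|j x fx IH].
  by apply: Sp_sub (kw_E i kx) => y ky; apply/Sp_in/fw_kw.
apply: Sp_eqW (relEF (fw_Falg fx) i j) _; apply: lspan_add; first exact: Spfw_F.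
by apply/lspan_scale/lspan_sub; [apply: SpfwK|apply: SpfwKi]; apply: Sp_in.
Qed.

(** The span of [fw] contains v and is stable under every letter: E- and K-letters are moved right
    past the F's into the top layer. *)
Lemma Falg_Spfw x : Falg x -> Sp fw x.
Proof.
elim=> [|_ [w ->]|? ? _ IHf _ IHg|? ? _ IHf]; last 2 first.
- exact: lspan_add.
- exact: lspan_scale.
- exact: lspan0.
elim: w => [|l w IH]; first by apply/Sp_in/fw_kw/kw_one.
rewrite -lmul_mono; case: l; [exact: (SpfwE false)|exact: (SpfwE true)|exact: (Spfw_F false)
 |exact: (Spfw_F true)|exact: (SpfwK false)|exact: (SpfwKi false)|exact: (SpfwK true)|exact: (SpfwKi true)].
Qed.

(** This is the Serre relation in F2, F2, F1 rewritten through F3. *)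
Lemma F3F2 x : Falg x -> eqW (F3 (lmul lF2 x)) (pscale q^-1 (lmul lF2 (F3 x))).
Proof.
move=> Fx; have := relFF Fx (isT : true != false); rewrite /eqW /F3 /= => H.
rewrite (_ : psub _ _ = padd (psub (lmul lF2 (lmul lF2 (lmul lF1 x)))
      (pscale (q + q^-1) (lmul lF2 (lmul lF1 (lmul lF2 x)))))
     (lmul lF1 (lmul lF2 (lmul lF2 x)))) //.
rewrite lmulB lmulZ; pointwise; field; exact: q0.
Qed.

Lemma F1F3 x : Falg x -> eqW (lmul lF1 (F3 x)) (pscale q^-1 (F3 (lmul lF1 x))).
Proof.
move=> Fx; have := relFF Fx (isT : false != true); rewrite /eqW /F3 /= => H.
rewrite (_ : psub _ _ = padd (psub (lmul lF1 (lmul lF1 (lmul lF2 x)))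
      (pscale (q + q^-1) (lmul lF1 (lmul lF2 (lmul lF1 x)))))
     (lmul lF2 (lmul lF1 (lmul lF1 x)))) //.
rewrite lmulB lmulZ; pointwise; field; exact: q0.
Qed.

Lemma Sp_F3 (A B : ncpoly -> Prop) :
  (forall x, A x -> Sp B (F3 x)) -> forall x, Sp A x -> Sp B (F3 x).
Proof.
move=> AB x; rewrite /F3; elim=> [|g [Wg|/AB //]|f g _ IHf _ IHg|a f _ IHf].
- by rewrite !lmul0 (_ : psub _ _ = pzero); [exact: lspan0 | pointwise; ring].
- by apply: Sp_W; apply: lspan_sub => //; [|apply: lspan_scale]; do 2!apply: W_lmul; apply: lspan_gen.
- by rewrite !lmulD; have := lspan_add IHf IHg; congr lspan; pointwise; ring.
- by rewrite !lmulZ; have := lspan_scale a IHf; congr lspan; pointwise; ring.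
Qed.

Lemma Spf23w_F2 x : Sp f23w x -> Sp f23w (lmul lF2 x).
Proof. by apply: Sp_lmul => y fy; apply/Sp_in/f23w_F2. Qed.

Lemma Spf23w_F3 x : Sp f23w x -> Sp f23w (F3 x).
Proof.
apply: Sp_F3 => {}x; elim=> {x} [x fx|x fx IH]; first by apply/Sp_in/f23w_f3w/f3w_F3.
by apply: Sp_eqW (F3F2 (f23w_Falg fx)) _; apply/lspan_scale/Spf23w_F2.
Qed.

(** F1 is moved right by F1 F2 = F3 + q F2 F1 and F1 F3 = q^-1 F3 F1 until it acts on the top
    layer. *)
Lemma Spf23w_F1 x : Sp f23w x -> Sp f23w (lmul lF1 x).
Proof.
apply: Sp_lmul => {}x; elim=> {x} [x|x fx IH].
  elim=> {x} [x kx|x fx IH].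
    by apply: Sp_sub (kw_F1 kx) => y ky; apply/Sp_in/f23w_f3w/f3w_kw.
  by apply: Sp_eqW (F1F3 (f23w_Falg (f23w_f3w fx))) _; apply/lspan_scale/Spf23w_F3.
rewrite (_ : lmul lF1 _ = padd (F3 x) (pscale q (lmul lF2 (lmul lF1 x)))).
  by apply: lspan_add; [apply/Spf23w_F3/Sp_in|apply/lspan_scale/Spf23w_F2].
by rewrite /F3; pointwise; ring.
Qed.

Lemma Falg_Spf23w x : Falg x -> Sp f23w x.
Proof.
move=> /Falg_Spfw; apply: Sp_sub => {}x; elim=> {x} [x kx|[] x _].
- by apply/Sp_in/f23w_f3w/f3w_kw.
- exact: Spf23w_F2.
- exact: Spf23w_F1.
Qed.

(** * The map to coefficient functions *)

Local Notation act := (op q al ka c).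
Local Notation v0 := (delta C 0 0 0).

(** The vector f v in coordinates: words act on v letter by letter, extended linearly. Linearity is
    available for finitely supported [f], hence the [Falg] conditions below. *)
Definition Phi (f : ncpoly) : vec C :=
  fun a b k => pairing f (fun w => foldr act v0 w a b k).

Lemma Phi_mono w : Phi (mono w) = foldr act v0 w.
Proof. by apply: vecP => a b k; apply: pairing_single. Qed.

Lemma Phi_comb s t f g : Falg f -> Falg g ->
  Phi (padd (pscale s f) (pscale t g)) = comb s t (Phi f) (Phi g).
Proof. by move=> /Falg_fin Ff /Falg_fin Fg; apply: vecP => a b k; apply: pairing_comb. Qed.

Lemma PhiD f g : Falg f -> Falg g -> Phi (padd f g) = comb 1 1 (Phi f) (Phi g).
Proof. by move=> Ff Fg; rewrite -Phi_comb // !scale1. Qed.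

Lemma PhiZ s f : Falg f -> Phi (pscale s f) = comb s 0 (Phi f) (Phi f).
Proof. by move=> Ff; rewrite -Phi_comb //; congr Phi; pointwise; ring. Qed.

Lemma PhiB f g : Falg f -> Falg g -> Phi (psub f g) = comb 1 (- 1) (Phi f) (Phi g).
Proof. by move=> Ff Fg; rewrite -Phi_comb // scale1. Qed.

Lemma Phi0 : Phi pzero = fun _ _ _ => 0.
Proof. by apply: vecP => a b k; apply: pairing0. Qed.

Lemma Phi_lmul l f : Falg f -> Phi (lmul l f) = act l (Phi f).
Proof.
elim=> [|_ [w ->]|g h Fg IHg Fh IHh|a g Fg IHg].
- by rewrite lmul0 Phi0 op0.
- by rewrite lmul_mono !Phi_mono.
- rewrite lmulD !PhiD; try exact: Falg_lmul; try by [].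
  by apply: vecP => i j k; rewrite op_comb /comb IHg IHh.
- rewrite lmulZ !PhiZ; try exact: Falg_lmul; try by [].
  by apply: vecP => i j k; rewrite op_comb /comb IHg.
Qed.

Lemma Phi_rel r v : Uq_rel q r -> Phi (pmul r (mono v)) = fun _ _ _ => 0.
Proof.
have Fv := Falg_mono v; move: (mono v) Fv => x Fx.
have F1 l := Falg_lmul l Fx; have F2 l m := Falg_lmul l (F1 m); have F3 l m n := Falg_lmul l (F2 m n).
case=> [[i]|[[i]|[|[[i [j]]|[[i [j]]|[[i [j]]|[[i [j [ij]]]|[i [j [ij]]]]]]]]]] ->;
  rewrite !(pmulBl, pmulZl, pmulDl) ?pmul_gen ?lmul_mono !pmul_mono /=;
  rewrite ?(PhiB, PhiD, PhiZ) ?Phi_lmul; auto 9; apply: vecP => a b k;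
  rewrite /comb.
- by rewrite op_KKi //; ring.
- by rewrite op_KiK //; ring.
- by rewrite /= opK1K2 //; ring.
- have /eqP := op_EF c q0 al0 ka0 nonroot i j (Phi x) a b k.
  by rewrite -subr_eq0 => /eqP E; rewrite -[RHS]E /qd; ring.
- by rewrite op_KEKi //; ring.
- by rewrite op_KFKi //; ring.
- by rewrite -[RHS](op_EE c q0 al0 ka0 nonroot (Phi x) a b k ij); ring.
- by rewrite -[RHS](op_FF c q0 al0 ka0 nonroot (Phi x) a b k ij); ring.
Qed.

Lemma Phi_pmul0 u f : Falg f -> Phi f = (fun _ _ _ => 0) -> Phi (pmul (mono u) f) = fun _ _ _ => 0.
Proof.
move=> Ff f0; rewrite pmul_mono; suff [] : Falg (foldr lmul f u) /\ Phi (foldr lmul f u) = fun _ _ _ => 0 by [].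
elim: u => //= l u [Fu IH]; split; first exact: Falg_lmul.
by rewrite Phi_lmul // IH op0.
Qed.

Lemma E1_v0 : act lE1 v0 = fun a b k => al * v0 a b k.
Proof.
apply: vecP => a b k; rewrite /= opE1E /delta.
have [->|a0] := eqVneq a 0; last first.
  have [->|b1] := eqVneq (b + 1) 0; first by rewrite qn0 ?(mulr0, mul0r) ?addr0.
  by rewrite !andbF !mulr0 addr0.
have [->|k0] := eqVneq k 0; last by rewrite !andbF !mulr0 add0r.
by rewrite expr0z mulr1 /= mulr0 addr0.
Qed.

Lemma E2_v0 : act lE2 v0 = fun _ _ _ => 0.
Proof.
apply: vecP => a b k; rewrite /= /opE2 /delta.
have [->|a1] := eqVneq (a + 1) 0; last first.
  have [->|b1] := eqVneq (b + 1) 0; first by rewrite qn0 !(mulr0, mul0r, subr0).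
  by rewrite !andbF /= ?(mulr0, mul0r, addr0, subr0).
rewrite qn0; have [->|b1] := eqVneq (b + 1) 0; first by rewrite qn0 !(mulr0, mul0r, subr0).
by rewrite !andbF /= ?(mulr0, mul0r, addr0, subr0).
Qed.

Lemma act_scale l s x : act l (comb s 0 x x) = comb s 0 (act l x) (act l x).
Proof. by apply: vecP => a b k; rewrite op_comb. Qed.

Lemma act_E w : all isE w -> foldr act v0 w = comb (eta_word al w) 0 v0 v0.
Proof.
elim: w => [|l w IH] /=; first by move=> _; apply: vecP => a b k; rewrite /comb /eta_word /=; ring.
case/andP=> lE /IH ->; rewrite act_scale; apply: vecP => a b k; rewrite /comb /eta_word /=.
case/orP: lE => /eqP ->; last by rewrite E2_v0 /=; ring.
by rewrite E1_v0 /=; case: ifP => _; rewrite ?exprS; ring.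
Qed.

Lemma Phi_Kel : Phi Kel = comb ka 0 v0 v0.
Proof.
rewrite Phi_mono /=; apply: vecP => a b k; rewrite [LHS](opKE ka q0) /comb /delta.
have [->|] := eqVneq a 0; last by rewrite !mulr0 addr0.
have [->|] := eqVneq b 0; last by rewrite !mulr0 addr0.
by rewrite addr0 expr0z expr1n invr1 mulr1; ring.
Qed.

Lemma Phi_C1el : Phi (C1el q) = comb c 0 v0 v0.
Proof.
have F1 := Falg_mono; rewrite /C1el /gen !(PhiD, PhiZ) ?Phi_mono; auto 7.
rewrite [foldr _ _ [:: lF1; lE1]]/= (_ : opE1 _ _ _ _ = act lE1 v0) // E1_v0.
rewrite (_ : (fun _ _ _ => _) = comb al 0 v0 v0); last first.
  by apply: vecP => a b k; rewrite /comb; ring.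
rewrite (_ : opF1 _ _ _ _ _ = act lF1 (comb al 0 v0 v0)) // act_scale /=.
apply: vecP => a b k; rewrite /comb /opF1 /opK1 /opK1i !addr0 -/(qd q).
have -> : qn q (q ^ (a + 1)) * v0 (a + 1) (b - 1) k = 0.
  rewrite /delta; have [->|_] := eqVneq (a + 1) 0; last by rewrite mulr0.
  by rewrite qn0 mul0r.
rewrite /delta; have [->|] := eqVneq a 0; last by move=> _ /=; ring.
have [->|] := eqVneq b 0; last by move=> _ /=; ring.
rewrite /= !expr0z; have d0 := qd_neq0 q0 nonroot.
(* The value at k = 0 is c; at k = -2 and k = 2 the terms from K1 v and K1^-1 v cancel those in F1
   E1 v. *)
have [->|k0] := eqVneq k 0.
  by rewrite /= expr0z; field; rewrite al0 ka0 q0 d0.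
have [k2|k2] := eqVneq (k + 2) 0.
  have -> : k = - 2 by lia.
  by rewrite /= -invr_expz -exprnP; field; rewrite al0 ka0 q0 d0.
have [k3|k3] := eqVneq (k - 2) 0; last by rewrite /=; ring.
have -> : k = 2 by lia.
by rewrite /= -exprnP; field; rewrite al0 ka0 q0 d0.
Qed.

Lemma Phi_W f : W f -> Phi f = fun _ _ _ => 0.
Proof.
have Phi_pconst a : Phi (pconst a) = comb a 0 v0 v0 by rewrite PhiZ // Phi_mono.
(* Membership in the free algebra is carried along for the linearity of [Phi]. *)
move=> Wf; suff [] : Falg f /\ Phi f = (fun _ _ _ => 0) by [].
elim: Wf => [|g Wg|g h _ [Fg g0] _ [Fh h0]|a g _ [Fg g0]]; split.
- exact: lspan0.
- exact: Phi0.
- exact/W_Falg/lspan_gen.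
- case: Wg => [[[u [v [r [rr ->]]]]|[u [w [ew ->]]]]|[[u ->]|[u ->]]]; apply: Phi_pmul0.
  + exact: Falg_rel.
  + exact: Phi_rel.
  + exact: lspan_sub (Falg_mono _) (Falg_pconst _).
  + rewrite PhiB; [|exact: Falg_mono|exact: Falg_pconst].
    by rewrite Phi_mono act_E // Phi_pconst; apply: vecP => i j l; rewrite /comb; ring.
  + exact: lspan_sub (Falg_mono _) (Falg_pconst _).
  + rewrite PhiB; [|exact: Falg_mono|exact: Falg_pconst].
    by rewrite Phi_Kel Phi_pconst; apply: vecP => i j l; rewrite /comb; ring.
  + exact: lspan_sub Falg_C1el (Falg_pconst _).
  + rewrite PhiB; [|exact: Falg_C1el|exact: Falg_pconst].
    by rewrite Phi_C1el Phi_pconst; apply: vecP => i j l; rewrite /comb; ring.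
- exact: lspan_add.
- by rewrite PhiD // g0 h0; apply: vecP => i j l; rewrite /comb; ring.
- exact: lspan_scale.
- by rewrite PhiZ // g0; apply: vecP => i j l; rewrite /comb; ring.
Qed.

(** * The PBW basis and the kernel of [Phi] *)

Definition kpow (k : int) : ncpoly :=
  match k with Posz n => iter n (lmul lK2) one | Negz n => iter n.+1 (lmul lK2i) one end.

Definition pbw (a b : nat) (k : int) : ncpoly := iter a (lmul lF2) (iter b F3 (kpow k)).

Lemma Falg_iter (T : ncpoly -> ncpoly) n x : (forall y, Falg y -> Falg (T y)) -> Falg x -> Falg (iter n T x).
Proof. by move=> FT Fx; elim: n => //= n; apply: FT. Qed.

Lemma Falg_kpow k : Falg (kpow k).
Proof. by case: k => n; apply: Falg_iter => // y; apply: Falg_lmul. Qed.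

Lemma Falg_pbw a b k : Falg (pbw a b k).
Proof.
apply: Falg_iter => [y|]; first exact: Falg_lmul.
by apply: Falg_iter (Falg_kpow k) => y; apply: F3_Falg.
Qed.

#[local] Instance F3_eqW : Proper (eqW ==> eqW) F3.
Proof.
move=> f g E; apply: psub_eqW; first by do 2!apply: lmul_eqW.
by apply: pscale_eqW; do 2!apply: lmul_eqW.
Qed.

Lemma kw_kpow x : kw x -> exists k, eqW x (kpow k).
Proof.
elim=> [|y _ [k E]|y _ [k E]]; first by exists 0; reflexivity.
- case: k E => [n|[|n]] E.
  + by exists n.+1; rewrite E; reflexivity.
  + by exists 0; rewrite E /= (KKi true F1s); reflexivity.
  + by exists (Negz n); rewrite E /= (KKi true (Falg_kpow (Negz n))); reflexivity.
- case: k E => [[|n]|n] E.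
  + by exists (Negz 0); rewrite E; reflexivity.
  + by exists n; rewrite E /= (KiK true (Falg_kpow n)); reflexivity.
  + by exists (Negz n.+1); rewrite E; reflexivity.
Qed.

Lemma f23w_pbw x : f23w x -> exists a b k, eqW x (pbw a b k).
Proof.
elim=> {x} [x fx|x _ [a [b [k E]]]]; last by exists a.+1, b, k; rewrite E; reflexivity.
exists 0; elim: fx => {x} [x /kw_kpow[k E]|x _ [b [k E]]]; first by exists 0, k.
by exists b.+1, k; apply: F3_eqW.
Qed.

Lemma Phi_F3 x : Falg x -> Phi (F3 x) = opF3 q (Phi x).
Proof.
move=> Fx; have F1 l := Falg_lmul l Fx; have F2 l m := Falg_lmul l (F1 m).
rewrite /F3 PhiB ?PhiZ ?Phi_lmul; auto; apply: vecP => a b k.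
by rewrite -[RHS](opF3E c q0 al0 ka0 nonroot) /comb /=; ring.
Qed.

Lemma Phi_kpow k : Phi (kpow k) = delta C 0 0 k.
Proof.
have up j x : Phi x = delta C 0 0 j -> act lK2 (Phi x) = delta C 0 0 (j + 1).
  move=> ->; apply: vecP => a b l; rewrite /= /opK2 !addr0 /delta subr_eq.
  have [->|_] := eqVneq a 0; last by rewrite mul0r.
  have [->|_] := eqVneq b 0; last by rewrite mul0r.
  by rewrite expr0z expr1n mulr1 divr1.
have down j x : Phi x = delta C 0 0 j -> act lK2i (Phi x) = delta C 0 0 (j - 1).
  move=> ->; apply: vecP => a b l; rewrite /= /opK2i !addr0 /delta -subr_eq opprK.
  have [->|_] := eqVneq a 0; last by rewrite mulr0.
  have [->|_] := eqVneq b 0; last by rewrite mulr0.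
  by rewrite expr0z expr1n !mul1r.
case: k => n.
  elim: n => [|n IH]; first exact: Phi_mono.
  rewrite [kpow _]/= Phi_lmul ?(up n) //; last exact: (Falg_kpow n).
  by congr delta; lia.
elim: n => [|n IH].
  by rewrite [kpow _]/= Phi_lmul ?(down 0) //; apply: Phi_mono.
rewrite [kpow _]/= Phi_lmul; last exact: (Falg_kpow (Negz n)).
rewrite (down (Negz n)) //; congr delta; lia.
Qed.

(** Distinct PBW monomials go to distinct basis functions, which makes them independent modulo W. *)
Lemma Phi_pbw a b k : Phi (pbw a b k) = delta C a b k.
Proof.
rewrite /pbw; elim: a => [|a IH] /=.
  elim: b => [|b IH] /=; first exact: Phi_kpow.
  have Fb : Falg (iter b F3 (kpow k)) by apply: (Falg_pbw 0).
  rewrite Phi_F3 // IH; apply: vecP => i j l; rewrite /opF3 !addr0 /delta subr_eq.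
  have -> : b%:Z + 1 = b.+1 by lia.
  have [->|_] := eqVneq i 0; last by rewrite mul0r.
  by rewrite expr0z divr1.
rewrite Phi_lmul; last exact: Falg_pbw.
rewrite IH; apply: vecP => i j l; rewrite /= /opF2 !addr0 /delta subr_eq.
by have -> : a%:Z + 1 = a.+1 by lia.
Qed.

Lemma eqW_Phi f g : Falg f -> Falg g -> eqW f g -> Phi f = Phi g.
Proof.
move=> Ff Fg /Phi_W; rewrite PhiB // => E; apply: vecP => a b k.
have := congr1 (fun x => x a b k) E; rewrite /comb mul1r mulN1r => /eqP.
by rewrite subr_eq0 => /eqP.
Qed.

Definition uncurry (x : vec C) (i : int * int * int) : C := x i.1.1 i.1.2 i.2.

(** Rebuilds an element from its coordinates. The absolute values only turn integer indices into
    exponents: coordinates in the image of [Phi] live at nonnegative a, b. *)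
Definition Psi (x : vec C) : ncpoly :=
  fun w => pairing (uncurry x) (fun i => pbw `|i.1.1|%N `|i.1.2|%N i.2 w).

Lemma Psi_comb s t x y : fin_supp (uncurry x) -> fin_supp (uncurry y) ->
  Psi (comb s t x y) = padd (pscale s (Psi x)) (pscale t (Psi y)).
Proof. by move=> fx fy; apply: functional_extensionality => w; apply: pairing_comb. Qed.

Lemma Psi0 : Psi (fun _ _ _ => 0) = pzero.
Proof. by apply: functional_extensionality => w; apply: pairing0. Qed.

Lemma uncurry_delta (a b k : int) : uncurry (delta C a b k) = fun i => (i == (a, b, k))%:R.
Proof. by apply: functional_extensionality => -[[a' b'] k']. Qed.

Lemma Psi_delta (a b : nat) (k : int) : Psi (delta C a b k) = pbw a b k.
Proof.
by apply: functional_extensionality => w; rewrite /Psi uncurry_delta pairing_single.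
Qed.

(** The three properties pass to linear combinations and hold on W and on the PBW monomials, which
    together span. The last one identifies the kernel of [Phi] with W. *)
Lemma Phi_kernel f : Falg f ->
  [/\ fin_supp (uncurry (Phi f)), exists B, bounded B (Phi f) & eqW f (Psi (Phi f))].
Proof.
move=> Ff; suff [] : Falg f /\
  [/\ fin_supp (uncurry (Phi f)), exists B, bounded B (Phi f) & eqW f (Psi (Phi f))] by [].
have fin0 : fin_supp (uncurry (fun _ _ _ => 0)) by exists [::].
elim: (Falg_Spf23w Ff) => [|g [Wg|fg]|g h _ [Fg [fg [B bg] Eg]] _ [Fh [fh [D bh] Eh]]|s g _ [Fg [fg [B bg] Eg]]].
- by split; [exact: lspan0|rewrite Phi0 Psi0; split; [|exists 0%N|reflexivity]].
- have {}Wg : W g by apply: lspan_gen.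
  split; first exact: W_Falg.
  rewrite Phi_W // Psi0; split; [by []|by exists 0%N|].
  by rewrite /eqW (_ : psub g pzero = g) //; pointwise; ring.
- have Fg := f23w_Falg fg; split=> //; have [a [b [k E]]] := f23w_pbw fg.
  rewrite (eqW_Phi Fg (Falg_pbw a b k) E) Phi_pbw Psi_delta; split=> //.
    by rewrite uncurry_delta; apply: fin_supp_single.
  exists (a + b + absz k)%N => a' b' k'; rewrite /delta.
  have [->|] := eqVneq a' a => //; have [->|] := eqVneq b' b => //.
  by have [->|] := eqVneq k' k => //; lia.
- split; first exact: lspan_add.
  rewrite PhiD //; split.
  + exact: (fin_supp_comb 1 1 fg fh).
  + exists (maxn B D) => a b k ab; rewrite /comb bg ?bh ?mulr0 ?addr0 //; lia.
  + by rewrite Psi_comb // !scale1; apply: padd_eqW.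
- split; first exact: lspan_scale.
  rewrite PhiZ //; split.
  + exact: (fin_supp_comb s 0 fg fg).
  + by exists B => a b k ab; rewrite /comb bg // !mulr0 addr0.
  + rewrite Psi_comb // (_ : padd _ _ = pscale s (Psi (Phi g))); first exact: pscale_eqW.
    by pointwise; ring.
Qed.

Lemma Phi_eq0_W f : Falg f -> Phi f = (fun _ _ _ => 0) -> W f.
Proof.
move=> Ff f0; have [_ _] := Phi_kernel Ff; rewrite f0 Psi0 /eqW.
by rewrite (_ : psub f pzero = f) //; pointwise; ring.
Qed.

(** Induction on a list of indices containing the support, one PBW monomial being subtracted at a
    time. *)
Lemma Phi_surj (s : seq (nat * nat * int)) (x : vec C) :
    (forall a b k, x a b k != 0 -> exists2 i, i \in s & [/\ a = i.1.1, b = i.1.2 & k = i.2]) ->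
  exists2 f, Falg f & Phi f = x.
Proof.
elim: s x => [|[[a b] k] s IH] x xs.
  exists pzero; first exact: lspan0.
  rewrite Phi0; apply: vecP => a b k; apply/esym/eqP.
  by apply: contraT => /xs[].
have [a' b' k'|f Ff fx] := IH (comb 1 (- x a b k) x (delta C a b k)).
  rewrite /comb /delta => H; have x0 : x a' b' k' != 0.
    apply: contraNneq H => x0; rewrite x0.
    have [/andP[/andP[/eqP E1 /eqP E2] /eqP E3]|] := boolP ((a' == a) && (b' == b) && (k' == k)).
      by rewrite -E1 -E2 -E3 x0 !mulr0 oppr0 mul0r addr0.
    by rewrite !mulr0 addr0.
  have [i] := xs _ _ _ x0; rewrite inE => /predU1P[->|si E]; last by exists i.
  case=> /= E1 E2 E3; move: H; rewrite E1 E2 E3 !eqxx /= mulr1 mul1r.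
  by rewrite subrr eqxx.
exists (padd (pscale 1 f) (pscale (x a b k) (pbw a b k))).
  by apply: lspan_add; apply: lspan_scale => //; apply: Falg_pbw.
rewrite Phi_comb //; last exact: Falg_pbw.
by rewrite fx Phi_pbw; apply: vecP => i j l; rewrite /comb; ring.
Qed.

(** * Submodules containing W *)

Lemma W_proper : ~ W one.
Proof.
move=> /Phi_W; rewrite Phi_mono /= => /(congr1 (fun x => x 0 0 0)).
by rewrite /delta !eqxx /= => /eqP; rewrite oner_eq0.
Qed.

Definition submodT (T : ncpoly -> Prop) := [/\ Defs.subsetP W T, Defs.subsetP T Falg,
  Defs.subsetP (lspan T) T & forall l f, T f -> T (lmul l f)].

Lemma submodT_one (T : ncpoly -> Prop) : T one -> submodT T -> Defs.subsetP Falg T.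
Proof.
move=> T1 [WT _ TT Tl] f Ff; apply: TT; apply: lspan_mono Ff => _ [w ->].
by apply: lspan_gen; elim: w => [//|l w IH]; rewrite -lmul_mono; apply: Tl.
Qed.

(** The image of T under [Phi] is stable under the operators and nonzero, hence contains v. A
    preimage of v in T differs from [one] by an element of W, which lies in T. *)
Lemma noncritical_one (T : ncpoly -> Prop) f : (forall n, hpol q ka c n.+1 != 0) ->
  submodT T -> T f -> ~ W f -> T one.
Proof.
move=> hn [WT TF TT Tl] Tf nWf.
pose N y := exists2 g, T g & Phi g = y.
have NTl l y : N y -> N (act l y).
  by case=> g Tg <-; exists (lmul l g); [exact: Tl | rewrite Phi_lmul //; exact: TF].
have sN : vsubmod q al ka c N.
  split; [|exact: (NTl lE1)|exact: (NTl lE2)|exact: (NTl lK1)|exact: (NTl lK2)|exact: (NTl lK2i)].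
  move=> s t x y [g Tg <-] [h Th <-]; exists (padd (pscale s g) (pscale t h)).
    by apply: TT; apply: lspan_add; apply/lspan_scale/lspan_gen.
  by rewrite Phi_comb //; exact: TF.
have bN y : N y -> exists B, bounded B y.
  by case=> g /TF Fg <-; have [] := Phi_kernel Fg.
have [g Tg g1] : N v0.
  apply: (vsubmod_delta q0 al0 ka0 nonroot sN bN hn (x := Phi f)); first by exists f.
  apply: NNPP => /nzN f0; apply: nWf; apply: Phi_eq0_W; first exact: TF.
  exact: vecP.
have Wg : W (psub g one).
  apply: Phi_eq0_W; first by apply: lspan_sub => //; exact: TF.
  rewrite PhiB //; last exact: TF.
  by rewrite g1 Phi_mono; apply: vecP => a b k; rewrite /comb /=; ring.
rewrite (_ : one = psub g (psub g one)); last by pointwise; ring.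
by apply: TT; apply: lspan_sub; apply: lspan_gen => //; apply: WT.
Qed.

(** The submodule is the preimage of [singmod]. It misses [one], whose image has degree 0, and
    contains a preimage of the singular vector, which is not in W. *)
Lemma critical_submodule n : hpol q ka c n.+1 = 0 ->
  exists T, [/\ submodT T, ~ T one & exists2 f, T f & ~ W f].
Proof.
move=> hn; pose S := singmod q al ka c n.+1.
have S0 : S (fun _ _ _ => 0).
  apply: (@singmod_scale _ _ _ _ _ _ 0 (sing q al ka n.+1)) => [a b k|]; first by rewrite mul0r.
  exact/singmod_kspan/kspan_sing.
have Scomb := @singmod_comb _ q al ka c n.+1.
exists (fun f => Falg f /\ S (Phi f)); split.
- split.
  + by move=> f Wf; split; [exact: W_Falg | rewrite Phi_W].
  + by move=> f [].
  + move=> f; elim=> [|//|g h _ [Fg Sg] _ [Fh Sh]|s g _ [Fg Sg]].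
    * by split; [exact: lspan0 | rewrite Phi0].
    * by split; [exact: lspan_add | rewrite PhiD //; apply: Scomb].
    * by split; [exact: lspan_scale | rewrite PhiZ //; apply: Scomb].
  + move=> l f [Ff Sf]; split; first exact: Falg_lmul.
    by rewrite Phi_lmul //; apply: singmod_op.
- case=> _; rewrite Phi_mono => /singmod_low low.
  have := low q0 al0 ka0 0 0 0; rewrite /= /delta !eqxx /= => H.
  by have /eqP := H isT; rewrite oner_eq0.
- have [f Ff fx] : exists2 f, Falg f & Phi f = sing q al ka n.+1.
    (* The support lies in degree n + 1, and [sing_coef_supp] bounds k by 2(n + 1). *)
    apply: (@Phi_surj [seq (i, (n.+1 - i)%N, l%:Z) | i <- iota 0 n.+2, l <- iota 0 (n.+1 + n.+1).+1] (sing q al ka n.+1)).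
    move=> a b k; have [/and3P[a0 b0 ab]|ab] := boolP [&& 0 <= a, 0 <= b & a + b == n.+1]; last first.
      by rewrite sing_out ?eqxx.
    case: a a0 ab => // i _ ab; case: b b0 ab => // j _ ab.
    have ij : (i + j)%N = n.+1 by lia.
    rewrite (sing_in _ _ _ _ ij) => nz0.
    have kb : 0 <= k <= (i + i)%N%:Z.
      by apply: contraR nz0 => kb; rewrite sing_coef_supp.
    exists (i, (n.+1 - i)%N, k); last by split=> //=; lia.
    have -> : k = (absz k)%:Z by lia.
    by apply: (allpairs_f (fun i l => (i, (n.+1 - i)%N, l%:Z))); rewrite mem_iota; lia.
  exists f.
    by split=> //; rewrite fx; apply/singmod_kspan/kspan_sing.
  by move=> /Phi_W; rewrite fx => f0; have [a [b [k]]] := nz_sing q al ka n.+1; rewrite f0 eqxx.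
Qed.
End Quotient.

(** * Maximality and irreducibility *)

Theorem theorem4p7 (q alpha kappa c : C)
  (hq0 : q != 0) (hq_nonroot : forall n : nat, (0 < n)%N -> q ^+ n != 1)
  (halpha : alpha != 0) (hkappa : kappa != 0) :
  (maximal_submod (lspan (Mgens q alpha)) (lspan (Wgens q alpha kappa c))
     <-> ~ critical q kappa c)
  /\
  (whittaker_quot alpha (lspan (Wgens q alpha kappa c))
   /\ irreducible_quot (lspan (Wgens q alpha kappa c))
     <-> ~ critical q kappa c).
Proof.
set W := lspan (Wgens q alpha kappa c); set M := lspan (Mgens q alpha).
have MW f : M f -> W f by apply: lspan_mono => g Mg; apply: lspan_gen; left.
have WW f : lspan W f -> W f by apply: lspan_mono.
(* As the relations of M(eta) lie in W, submodules of M(eta) above W and submodules of V are given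
   by the same subspaces T. *)
have submodE B T : (forall f, W f -> T f) -> submod_of B T -> submodT q alpha kappa c T.
  by move=> WT [_ [TF [TT Tl]]]; split=> // l f Tf; rewrite -pmul_gen; apply: Tl.
have submodI B T : (forall f, B f -> W f) -> submodT q alpha kappa c T -> submod_of B T.
  move=> BW [WT TF TT Tl]; split; first by move=> f /BW; apply: WT.
  by split=> //; split=> // l f Tf; rewrite pmul_gen; apply: Tl.
have subW : submodT q alpha kappa c W.
  by split=> //; [exact: W_Falg | move=> l f; exact: W_lmul].
have nW1 : ~ W one by apply: W_proper.
have F1 : Falg one by apply: Falg_mono.
(* The critical index starts at 1, matching the degrees m + 1 of the descent. *)
have nc : ~ critical q kappa c -> forall n, hpol q kappa c n.+1 != 0.
  by move=> ncr n; apply/eqP => h0; apply: ncr; exists n.+1.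
have full T f : ~ critical q kappa c -> submodT q alpha kappa c T -> T f -> ~ W f -> Defs.subsetP Falg T.
  move=> /nc hn sT Tf nWf; apply: submodT_one (sT).
  exact: (noncritical_one hq0 hq_nonroot halpha hkappa hn sT Tf nWf).
have dich T : ~ critical q kappa c -> submodT q alpha kappa c T -> Defs.subsetP T W \/ Defs.subsetP Falg T.
  move=> ncr sT; have [[f [Tf nWf]]|H] := classic (exists f, T f /\ ~ W f).
    by right; apply: full sT Tf nWf.
  by left=> f Tf; apply: NNPP => nWf; apply: H; exists f.
(* In the critical case a submodule lies strictly between W and the free algebra. *)
have crit : critical q kappa c ->
    exists T, [/\ submodT q alpha kappa c T, ~ Defs.subsetP T W & ~ Defs.subsetP Falg T].
  case=> [[[]//|n]] [_ h0].
  have [T [sT nT1 [f Tf nWf]]] := critical_submodule hq0 hq_nonroot halpha hkappa (h0 : hpol q kappa c n.+1 = 0).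
  by exists T; split=> // [/(_ _ Tf)|/(_ _ F1)].
split; split.
- move=> [_ [_ maxW]] /crit[T [sT nTW nFT]].
  by have [WT _ _ _] := sT; case: (maxW T (submodI _ _ MW sT) WT).
- move=> ncr; split; first exact: submodI.
  split; first by exists one.
  by move=> T sT WT; apply: dich => //; apply: submodE WT sT.
- move=> [_ [_ irr]] /crit[T [sT nTW nFT]].
  by case: (irr T (submodI _ _ (fun _ Wf => Wf) sT)).
- move=> ncr; split; last first.
    split; first by exists one.
    by move=> T sT; apply: dich => //; have [WT _] := sT; apply: submodE sT.
  (* The class of [one] is the Whittaker vector, and it generates everything. *)
  exists one; split=> //; split=> //; split.
    by rewrite pmul_gen; apply: E1_one.
  split.
    have := @E2_one q alpha kappa c; rewrite pmul_gen /eqW.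
    by congr lspan; pointwise; ring.
  move=> T sT T1; have [WT _] := sT; apply: submodT_one T1 _; exact: submodE sT.
Qed.
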